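(* Let $k$ be a field of characteristic $p>0$, let $K=k((t))$, and let $F/K(x)$ be the degree $p$ Galois extension of the rational function field $K(x)$ defined by the Artin–Schreier equation $Y^p-Y=\frac{t}{x}+\frac{t}{x-1}$. Let $P:=Z^p-Z-\frac{t}{x}\in F[Z]$. Then $P$ does not have a root in $F$, but $P$ does have a root in the completion $F_v$ for every discrete valuation $v$ of $F$. Consequently, if $p>2$, the local-global principle for Levi factors over $F$ fails; that is, there exists a linear algebraic group $G$ over $F$ whose unipotent radical is defined over $F$ such that $G$ has no Levi factor over $F$, but for every discrete valuation $v$ on $F$ the base change $G_{F_v}$ has a Levi factor over $F_v$.
   Context: A linear algebraic group over a field $F$ is a smooth affine group scheme of finite type over $F$ (not necessarily connected). Over an algebraically closed field, the unipotent radical $R_u(G)$ is the largest connected normal unipotent subgroup of $G$, and $G$ is called reductive if $R_u(G)$ is trivial (so reductive groups need not be connected). For $G$ over a field $F$ with algebraic closure $\bar F$, the unipotent radical of $G$ is said to be defined over $F$ if the largest connected normal unipotent $F$-subgroup $U$ of $G$ satisfies $U_{\bar F}=R_u(G_{\bar F})$; in that case one writes $R_u(G)=U$. A Levi factor of such a $G$ (over $F$) is an $F$-subgroup $M\subseteq G$ that maps isomorphically onto $G/R_u(G)$ under the quotient map; equivalently, it is the image of a homomorphic section of $G\to G/R_u(G)$ over $F$. For a discrete valuation $v$ on $F$ (not assumed trivial on any subfield), $F_v$ denotes the $v$-adic completion of $F$. *)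

(* Defs.v *)
From HB Require Import structures.
From mathcomp Require Import all_boot all_order all_algebra all_field.
From mathcomp Require Import boolp.
From mathcomp Require Import mpoly.

Set Implicit Arguments.
Unset Strict Implicit.
Unset Printing Implicit Defensive.

Import Order.TTheory GRing.Theory Num.Theory.
Local Open Scope ring_scope.

(* [k[[t]]]: a series is the sequence of its coefficients.  The record keeps
   the Cauchy product apart from the pointwise product of functions. *)
Record fps (k : fieldType) := Fps { fcoef : nat -> k }.

Section FormalPowerSeries.
Variable k : fieldType.
Implicit Types f g h : fps k.

HB.instance Definition _ := gen_eqMixin (fps k).
HB.instance Definition _ := gen_choiceMixin (fps k).

Definition fps_add f g := Fps (fun n => fcoef f n + fcoef g n).
Definition fps_opp f := Fps (fun n => - fcoef f n).
Definition fps_const (c : k) := Fps (fun n => if n == 0%N then c else 0).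
Definition fps_mul f g :=
  Fps (fun n => \sum_(i < n.+1) fcoef f i * fcoef g (n - i)%N).

Lemma fpsP f g : (forall n, fcoef f n = fcoef g n) -> f = g.
Proof. by case: f g => [f] [g] /= fg; congr Fps; apply: funext. Qed.

Fact fps_addA : associative fps_add.
Proof. by move=> f g h; apply: fpsP => n /=; rewrite addrA. Qed.
Fact fps_addC : commutative fps_add.
Proof. by move=> f g; apply: fpsP => n /=; rewrite addrC. Qed.
Fact fps_add0 : left_id (fps_const 0) fps_add.
Proof. by move=> f; apply: fpsP => n /=; rewrite if_same add0r. Qed.
Fact fps_addN : left_inverse (fps_const 0) fps_opp fps_add.
Proof. by move=> f; apply: fpsP => n /=; rewrite if_same addNr. Qed.

HB.instance Definition _ :=
  GRing.isZmodule.Build (fps k) fps_addA fps_addC fps_add0 fps_addN.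

Let trunc m f := \poly_(i < m) fcoef f i.

Let coef_trunc_mul m f g n : (n < m)%N ->
  fcoef (fps_mul f g) n = (trunc m f * trunc m g)`_n.
Proof.
move=> nm; rewrite coefM /=; apply: eq_bigr => i _.
rewrite !coef_poly (leq_ltn_trans (leq_subr _ _) nm).
by rewrite (leq_ltn_trans (leq_ord i) nm).
Qed.

Fact fps_mulA : associative fps_mul.
Proof.
move=> f g h; apply: fpsP => n.
transitivity (trunc n.+1 f * (trunc n.+1 g * trunc n.+1 h))`_n.
  rewrite coefM; apply: eq_bigr => i _.
  rewrite -(@coef_trunc_mul n.+1) ?ltnS ?leq_subr//.
  by rewrite coef_poly ltn_ord.
rewrite mulrA coefM; apply: eq_bigr => i _.
by rewrite -(@coef_trunc_mul n.+1) ?ltn_ord// coef_poly ltnS leq_subr.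
Qed.
Fact fps_mulC : commutative fps_mul.
Proof.
by move=> f g; apply: fpsP => n; rewrite !(@coef_trunc_mul n.+1)// mulrC.
Qed.
Fact fps_mul1 : left_id (fps_const 1) fps_mul.
Proof.
move=> f; apply: fpsP => n /=; rewrite big_ord_recl /= mul1r subn0.
by rewrite big1 ?addr0// => i _; rewrite /= mul0r.
Qed.
Fact fps_mulDl : left_distributive fps_mul fps_add.
Proof.
move=> f g h; apply: fpsP => n /=; rewrite -big_split /=.
by apply: eq_bigr => i _; rewrite mulrDl.
Qed.
Fact fps_one_neq0 : fps_const 1 != 0.
Proof.
apply/eqP => /(congr1 (fun f => fcoef f 0)) /= /eqP.
by rewrite oner_eq0.
Qed.

HB.instance Definition _ := GRing.Zmodule_isComNzRing.Build (fps k)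
  fps_mulA fps_mulC fps_mul1 fps_mulDl fps_one_neq0.

Definition fps_unit : pred (fps k) := fun f => `[< exists g, g * f = 1 >].
Definition fps_inv f : fps k :=
  if pselect (exists g, g * f = 1) is left e then projT1 (cid e) else f.

Fact fps_mulVr : {in fps_unit, left_inverse 1 fps_inv *%R}.
Proof.
move=> f /asboolP fu; rewrite /fps_inv.
by case: pselect => // e; case: (cid e).
Qed.
Fact fps_unitP f g : g * f = 1 -> fps_unit f.
Proof. by move=> gf; apply/asboolP; exists g. Qed.
Fact fps_inv_out : {in [predC fps_unit], fps_inv =1 id}.
Proof.
move=> f /= /asboolP fu; rewrite /fps_inv.
by case: pselect => // e; case: fu.
Qed.

HB.instance Definition _ :=
  GRing.ComNzRing_hasMulInverse.Build (fps k) fps_mulVr fps_unitP fps_inv_out.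

Let fps_order f : f != 0 ->
  exists2 n, fcoef f n != 0 & forall i, (i < n)%N -> fcoef f i = 0.
Proof.
move=> f0; have ex : exists n, fcoef f n != 0.
  apply: contrapT => nf; case/eqP: f0; apply: fpsP => n /=.
  rewrite if_same; apply/eqP; apply: contrapT => /negP fn.
  by apply: nf; exists n.
case: (ex_minnP ex) => n fn nmin; exists n => // i; rewrite ltnNge => lt_in.
by apply/eqP; apply: contraNT lt_in => /nmin.
Qed.

Fact fps_idomain : GRing.integral_domain_axiom (fps k).
Proof.
move=> f g fg; apply: contrapT => /negP; rewrite negb_or => /andP[].
move=> /fps_order[m fm fm0] /fps_order[n gn gn0].
have : fcoef (f * g) (m + n) = 0 by rewrite fg /= if_same.
have mlt : (m < (m + n).+1)%N by rewrite ltnS leq_addr.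
rewrite /= (bigD1 (Ordinal mlt)) //= addKn big1 ?addr0 => [|i ne_im].
  by apply/eqP; rewrite mulf_neq0.
have [/fm0->|] := ltnP i m; first by rewrite mul0r.
rewrite leq_eqVlt => /orP[/eqP mi|mi].
  by case/eqP: ne_im; apply: val_inj.
by rewrite (gn0 (m + n - i)%N) ?mulr0// ltn_subLR ?ltn_add2r// -ltnS ltn_ord.
Qed.

HB.instance Definition _ :=
  GRing.ComUnitRing_isIntegral.Build (fps k) fps_idomain.

End FormalPowerSeries.

Definition laurent (k : fieldType) : fieldType := {fraction (fps k)}.

Definition laurent_ratfun (k : fieldType) : fieldType :=
  {fraction {poly (laurent k)}}.

Definition laurent_t (k : fieldType) : laurent k :=
  tofrac (Fps (fun n => if n == 1%N then 1 else 0)).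

Definition ratfun_t (k : fieldType) : laurent_ratfun k :=
  tofrac (laurent_t k)%:P.
Definition ratfun_x (k : fieldType) : laurent_ratfun k :=
  @tofrac {poly (laurent k)} 'X.

(* Normalised (value group [int]); the value at [0], which stands for
   infinity, is left unconstrained. *)
Record discrete_valuation (F : fieldType) (v : F -> int) : Prop := {
  valM : forall a b, a != 0 -> b != 0 -> v (a * b) = v a + v b;
  valD : forall a b, a != 0 -> b != 0 -> a + b != 0 ->
    Num.min (v a) (v b) <= v (a + b);
  val_onto : forall n, exists2 a, a != 0 & v a = n
}.

Definition val_ge (F : fieldType) (v : F -> int) (n : int) (a : F) : Prop :=
  a = 0 \/ n <= v a.

Definition val_cauchy (F : fieldType) (v : F -> int) (u : nat -> F) : Prop :=
  forall n : int, exists N : nat, forall i j, (N <= i)%N -> (N <= j)%N ->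
    val_ge v n (u i - u j).

Definition val_limit (F : fieldType) (v : F -> int) (u : nat -> F) (l : F) :
    Prop :=
  forall n : int, exists N : nat, forall i, (N <= i)%N -> val_ge v n (u i - l).

(* [j : F -> L] is a completion of [F] at [v], with extended valuation [w];
   this determines [L] up to a unique isomorphism over [F]. *)
Definition is_completion (F : fieldType) (v : F -> int) (L : fieldType)
    (j : {rmorphism F -> L}) : Prop :=
  exists w : L -> int,
    [/\ discrete_valuation w,
        forall a, a != 0 -> w (j a) = v a,
        forall (b : L) (n : int), exists a : F, val_ge w n (b - j a)
      & forall u, val_cauchy w u -> exists l, val_limit w u l].

Definition is_algebraic_closure (F E : fieldType) (i : {rmorphism F -> E}) :
    Prop :=
  GRing.closed_field_axiom E /\ forall z : E, algebraicOver i z.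

(* A finite sequence [I] of polynomials stands for the closed subscheme
   [Spec F[X_1..X_n]/(I)] of affine [n]-space; over a field every affine scheme
   of finite type is of this form.  Its functor of points is [point I]. *)

Definition eval (F : fieldType) (R : comAlgType F) n (f : {mpoly F[n]})
    (u : 'I_n -> R) : R := mmap (in_alg R) u f.

Definition evals (F : fieldType) (R : comAlgType F) n m
    (f : 'I_m -> {mpoly F[n]}) (u : {ffun 'I_n -> R}) : {ffun 'I_m -> R} :=
  [ffun i => eval (f i) u].

Definition point (F : fieldType) n (I : seq {mpoly F[n]}) (R : comAlgType F)
    (u : {ffun 'I_n -> R}) : Prop :=
  forall f, f \in I -> eval f u = 0.

Definition subscheme (F : fieldType) n (I J : seq {mpoly F[n]}) : Prop :=
  forall (R : comAlgType F) (u : {ffun 'I_n -> R}), point I u -> point J u.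

Definition in_ideal (F : fieldType) n (I : seq {mpoly F[n]}) (f : {mpoly F[n]}) :
    Prop :=
  exists c : 'I_(size I) -> {mpoly F[n]}, f = \sum_i c i * I`_i.

(* The coordinate ring has no idempotents besides 0 and 1; [I] is only used for
   schemes having a rational point, so the empty scheme is not an issue. *)
Definition connected_scheme (F : fieldType) n (I : seq {mpoly F[n]}) : Prop :=
  forall e, in_ideal I (e * e - e) -> in_ideal I e \/ in_ideal I (e - 1).

(* Infinitesimal lifting criterion; finite presentation is built in. *)
Definition smooth_scheme (F : fieldType) n (I : seq {mpoly F[n]}) : Prop :=
  forall (R S : comAlgType F) (q : {lrmorphism R -> S}),
    (forall s, exists r, q r = s) ->
    (forall a b, q a = 0 -> q b = 0 -> a * b = 0) ->
  forall u : {ffun 'I_n -> S}, point I u ->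
  exists2 u' : {ffun 'I_n -> R}, point I u' & forall i, q (u' i) = u i.

(* An affine scheme of finite type with polynomial maps meant as its
   multiplication, inverse and unit section. *)
Record group_data (F : fieldType) := GroupData {
  gdim : nat;
  geqs : seq {mpoly F[gdim]};
  gmul : 'I_gdim -> {mpoly F[gdim + gdim]};
  ginv : 'I_gdim -> {mpoly F[gdim]};
  gone : 'I_gdim -> F
}.

Section Points.
Variables (F : fieldType) (G : group_data F) (R : comAlgType F).
Local Notation pt := {ffun 'I_(gdim G) -> R}.

Definition pmul (u v : pt) : pt :=
  [ffun i => eval (gmul i)
     (fun l => match split l with inl a => u a | inr b => v b end)].
Definition pinv (u : pt) : pt := evals (@ginv F G) u.
Definition pone : pt := [ffun i => (gone i)%:A].

End Points.

Definition group_scheme (F : fieldType) (G : group_data F) : Prop :=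
  forall R : comAlgType F, let inG := @point F _ (geqs G) R in
  [/\ inG (pone G R),
      forall u v, inG u -> inG v -> inG (pmul u v) &
      forall u, inG u -> inG (pinv u)] /\
  [/\ forall u v w, inG u -> inG v -> inG w ->
        pmul u (pmul v w) = pmul (pmul u v) w,
      forall u, inG u -> pmul (pone G R) u = u &
      forall u, inG u -> pmul (pinv u) u = pone G R].

Definition linear_algebraic_group (F : fieldType) (G : group_data F) : Prop :=
  group_scheme G /\ smooth_scheme (geqs G).

Definition base_change (F L : fieldType) (j : {rmorphism F -> L})
    (G : group_data F) : group_data L :=
  @GroupData L (gdim G) (map (map_mpoly j) (geqs G))
    (fun i => map_mpoly j (gmul i)) (fun i => map_mpoly j (ginv i))
    (fun i => j (gone i)).

Section Subgroups.
Variables (F : fieldType) (G : group_data F).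
Implicit Types H U M : seq {mpoly F[gdim G]}.

Definition restrict H : group_data F :=
  @GroupData F (gdim G) H (@gmul F G) (@ginv F G) (@gone F G).

(* Subgroups are again linear algebraic groups, i.e. smooth. *)
Definition subgroup H : Prop :=
  subscheme H (geqs G) /\ linear_algebraic_group (restrict H).

Definition normal_subgroup H : Prop :=
  subgroup H /\
  forall (R : comAlgType F) (g h : {ffun 'I_(gdim G) -> R}),
    point (geqs G) g -> point H h -> point H (pmul (pmul g h) (pinv g)).

(* [H] is isomorphic to a closed subgroup of the group of upper unitriangular
   matrices of some size [N]: [a] is a homomorphism to that group, and it is a
   closed immersion because [b] expresses the coordinates on [H] as polynomials
   in the matrix entries. *)
Definition unipotent H : Prop :=
  exists N (a : 'M[{mpoly F[gdim G]}]_N) (b : 'I_(gdim G) -> {mpoly F[N * N]}),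
  forall R : comAlgType F,
  let A (u : {ffun 'I_(gdim G) -> R}) := \matrix_(i, j) eval (a i j) u in
  [/\ forall u, point H u -> forall i j : 'I_N, (j <= i)%N ->
        A u i j = (i == j)%:R,
      forall u v, point H u -> point H v -> A (pmul u v) = A u *m A v &
      forall u, point H u -> forall i, eval (b i) (mxvec (A u) 0) = u i].

Definition connected_normal_unipotent H : Prop :=
  [/\ normal_subgroup H, connected_scheme H & unipotent H].

Definition largest_connected_normal_unipotent U : Prop :=
  connected_normal_unipotent U /\
  forall H, connected_normal_unipotent H -> subscheme H U.

End Subgroups.

(* The unipotent radical of [G] is defined over [F] and equal to [U]. *)
Definition unipotent_radical (F : fieldType) (G : group_data F)
    (U : seq {mpoly F[gdim G]}) : Prop :=
  largest_connected_normal_unipotent U /\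
  forall (E : fieldType) (i : {rmorphism F -> E}), is_algebraic_closure i ->
    @largest_connected_normal_unipotent E (base_change i G)
      (map (map_mpoly i) U).

Definition homomorphism (F : fieldType) (G Q : group_data F)
    (f : 'I_(gdim Q) -> {mpoly F[gdim G]}) : Prop :=
  forall R : comAlgType F,
  (forall u : {ffun 'I_(gdim G) -> R},
     point (geqs G) u -> point (geqs Q) (evals f u)) /\
  (forall u v : {ffun 'I_(gdim G) -> R}, point (geqs G) u -> point (geqs G) v ->
     evals f (pmul u v) = pmul (evals f u) (evals f v)).

(* [f : G -> Q] makes [Q] the quotient [G/N]: it has kernel [N] and is a
   quotient map, i.e. the map of coordinate rings [F[Q] -> F[G]] is injective
   (for group schemes over a field this is the same as faithful flatness). *)
Definition quotient_by (F : fieldType) (G : group_data F)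
    (N : seq {mpoly F[gdim G]}) (Q : group_data F)
    (f : 'I_(gdim Q) -> {mpoly F[gdim G]}) : Prop :=
  [/\ linear_algebraic_group Q,
      homomorphism f,
      forall (R : comAlgType F) (u : {ffun 'I_(gdim G) -> R}),
        point (geqs G) u -> (point N u <-> evals f u = pone Q R)
    & forall h : {mpoly F[gdim Q]},
        in_ideal (geqs G) (mmap (@mpolyC _ F) f h) -> in_ideal (geqs Q) h].

(* The morphism [f] restricts to an isomorphism of schemes from [I] to [J]. *)
Definition restricts_to_iso (F : fieldType) n m (I : seq {mpoly F[n]})
    (J : seq {mpoly F[m]}) (f : 'I_m -> {mpoly F[n]}) : Prop :=
  exists s : 'I_n -> {mpoly F[m]}, forall R : comAlgType F,
  (forall u : {ffun 'I_n -> R}, point I u ->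
     point J (evals f u) /\ evals s (evals f u) = u) /\
  (forall v : {ffun 'I_m -> R}, point J v ->
     point I (evals s v) /\ evals f (evals s v) = v).

Definition Levi_factor (F : fieldType) (G : group_data F)
    (M : seq {mpoly F[gdim G]}) : Prop :=
  subgroup M /\
  exists U, unipotent_radical U /\
  exists (Q : group_data F) (f : 'I_(gdim Q) -> {mpoly F[gdim G]}),
    quotient_by U f /\ restricts_to_iso M (geqs Q) f.

(* Main.v *)
(** Write AS(z) = z^p - z.

    Globally, F / L is cyclic of degree p with L = K(x), so a root z of AS(z) = t/x
    would give n <> 0, m in F_p and u in L with AS(u) = n t/x - m (t/x + t/(x-1));
    the right-hand side would then have simple poles, which AS(u) never has.

    Locally, let v be a discrete valuation of F.  Every element of t k[[t]] is AS of an
    element of t k[[t]], so v >= 0 on k[[t]] by infinite descent.  If v(t/x) > 0 or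
    v(t/(x-1)) > 0, one of the two fractions is AS of an element of F_v, hence so is the
    other because their sum is AS(y).  Otherwise v(t) = 0, v is trivial on K, and x
    reduces to an algebraic element over K; by Weierstrass preparation either b or 1/b,
    for b = (x-1)/x, is integral over k[[t]] modulo the maximal ideal of v.  For such an
    integral element c the series - sum_i (t c)^(p^i) converges t-adically, so that t c,
    hence t/x = t - t b or t/(x-1) = t (1/b) - t, is AS of an element up to an element of
    positive valuation.

    For the group, take the extension of (Z/p)^2 by G_a^2 given by
      (b, c, u, w) (b', c', u', w') = (b+b', c+c', u+u', w+w' + b (AS(u') + a c')),
    the pullback of a Heisenberg group along (c, u) |-> AS(u) + a c.  Lifts of (1,0) and
    (0,1) commute if and only if AS(u') + a = 0, where u' is the third coordinate of the
    lift of (0,1), and such a u' yields a section; so a Levi factor exists exactly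
    when -a is in the image of AS; now take a = - t/x. *)
From HB Require Import structures.
Require Import Defs.
From mathcomp Require Import all_boot all_order all_fingroup all_algebra.
From mathcomp Require Import all_solvable all_field.
From mathcomp Require Import boolp mpoly ring zify.

Set Implicit Arguments.
Unset Strict Implicit.
Unset Printing Implicit Defensive.

Import Order.TTheory GRing.Theory Num.Theory.
Local Open Scope ring_scope.

(** * Affine schemes and their points *)

Section Ideals.
Variables (F : fieldType) (n : nat) (I : seq {mpoly F[n]}).

Lemma in_ideal_mem f : f \in I -> in_ideal I f.
Proof.
move=> If; have lt_i : (index f I < size I)%N by rewrite index_mem.
exists (fun i => (i == Ordinal lt_i)%:R).
rewrite (bigD1 (Ordinal lt_i)) //= eqxx mul1r nth_index // big1 ?addr0 //.
by move=> i /negbTE->; rewrite mul0r.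
Qed.

Lemma in_ideal0 : in_ideal I 0.
Proof. by exists (fun=> 0); rewrite big1 // => i _; rewrite mul0r. Qed.

Lemma in_idealMD c f g : in_ideal I f -> in_ideal I g -> in_ideal I (c * f + g).
Proof.
move=> [a ->] [b ->]; exists (fun i => c * a i + b i).
by rewrite mulr_sumr -big_split; apply: eq_bigr => i _; rewrite mulrDl mulrA.
Qed.

Lemma in_idealM c f : in_ideal I f -> in_ideal I (c * f).
Proof. by move=> If; rewrite -[_ * _]addr0; apply: in_idealMD => //; apply: in_ideal0. Qed.

End Ideals.

Section RestrictionOfScalars.
Variables (F B : comNzRingType) (h : {rmorphism F -> B}).

(** Indexing the synonym by the morphism lets each [h] give [B] its own [F]-algebra structure. *)
Definition alg_along of {rmorphism F -> B} : Type := B.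
Local Notation A := (alg_along h).

HB.instance Definition _ := GRing.ComNzRing.copy A B.

Let scale (a : F) (b : A) : A := h a * (b : B).

Fact alg_alongA a b v : scale a (scale b v) = scale (a * b) v.
Proof. by rewrite /scale rmorphM -mulrA. Qed.
Fact alg_along1 : left_id 1 scale.
Proof. by move=> v; rewrite /scale rmorph1 mul1r. Qed.
Fact alg_alongDr : right_distributive scale +%R.
Proof. by move=> a u v; rewrite /scale mulrDr. Qed.
Fact alg_alongDl v : {morph scale^~ v : a b / a + b}.
Proof. by move=> a b; rewrite /scale rmorphD mulrDl. Qed.

HB.instance Definition _ := GRing.Zmodule_isLmodule.Build F A
  alg_alongA alg_along1 alg_alongDr alg_alongDl.

Fact alg_alongl (a : F) (u v : A) : a *: (u * v) = (a *: u) * v.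
Proof. exact: mulrA. Qed.

HB.instance Definition _ := GRing.Lmodule_isLalgebra.Build F A alg_alongl.

Fact alg_alongr (a : F) (u v : A) : a *: (u * v) = u * (a *: v).
Proof. exact: mulrCA. Qed.

HB.instance Definition _ := GRing.Lalgebra_isAlgebra.Build F A alg_alongr.

Lemma alg_alongE (a : F) : a%:A = h a :> A.
Proof. exact: mulr1. Qed.

End RestrictionOfScalars.

(** Both sides agree on constants and variables, and every polynomial is a sum of products of
    these. *)
Lemma rmorph_eval (F : fieldType) (R : comAlgType F) n
    (q : {rmorphism {mpoly F[n]} -> R}) (u : 'I_n -> R) :
  (forall c, q c%:MP = c%:A) -> (forall i, q 'X_i = u i) ->
  forall g, eval g u = q g.
Proof.
move=> qC qX g; rewrite /eval /mmap [in RHS](mpolyE g) rmorph_sum.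
apply: eq_bigr => m _; rewrite -mul_mpolyC rmorphM qC /=; congr (_ * _).
rewrite mpolyXE_id rmorph_prod; apply: eq_bigr => i _.
by rewrite rmorphXn qX.
Qed.

(* Evaluate at the universal point, with values in the coordinate ring; that ring is a
   [comAlgType] only when it is nonzero, but otherwise the claim is trivial. *)
Lemma in_ideal_of_points (F : fieldType) n (I : seq {mpoly F[n]}) f :
  (forall (R : comAlgType F) (u : {ffun 'I_n -> R}), point I u -> eval f u = 0) ->
  in_ideal I f.
Proof.
move=> If0; have [I1 | I'1] := pselect (in_ideal I 1).
  by rewrite -[f]mulr1; apply: in_idealM.
pose S : {pred {mpoly F[n]}} := fun f => `[< in_ideal I f >].
have S_ideal : idealr_closed S.
  split; first by apply/asboolP/in_ideal0.
    by apply/asboolP.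
  by move=> a u v /asboolP uI /asboolP vI; apply/asboolP/in_idealMD.
pose J : idealr {mpoly F[n]} := HB.pack S (isIdealr.Build _ S S_ideal).
pose q : {rmorphism {mpoly F[n]} -> {ideal_quot J}} := \pi_{ideal_quot J}%qT.
pose h : {rmorphism F -> {ideal_quot J}} := q \o @mpolyC n F.
pose A : comAlgType F := alg_along h.
pose u : {ffun 'I_n -> A} := [ffun i => (q 'X_i : A)].
have evalE g : eval (R := A) g u = q g.
  by apply: (@rmorph_eval _ A) => [c | i]; rewrite ?alg_alongE ?ffunE.
have q0 g : q g = 0 <-> in_ideal I g.
  have -> : (q g = 0) = (q g == 0) by apply/propext; split=> /eqP.
  rewrite -(rmorph0 q) /q /= -Quotient.idealrBE subr0.
  by split=> /asboolP.
apply/q0; rewrite -evalE; apply: (If0 A) => g gI; rewrite evalE; apply/q0.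
exact: in_ideal_mem.
Qed.

Section Eval.
Variables (F : fieldType) (R : comAlgType F) (n : nat) (u : 'I_n -> R).

Definition eval_rmorphism : {rmorphism {mpoly F[n]} -> R} := mmap (in_alg R) u.

Lemma evalD f g : eval (f + g) u = eval f u + eval g u.
Proof. exact: (rmorphD eval_rmorphism). Qed.
Lemma evalB f g : eval (f - g) u = eval f u - eval g u.
Proof. exact: (rmorphB eval_rmorphism). Qed.
Lemma evalN f : eval (- f) u = - eval f u.
Proof. exact: (rmorphN eval_rmorphism). Qed.
Lemma evalM f g : eval (f * g) u = eval f u * eval g u.
Proof. exact: (rmorphM eval_rmorphism). Qed.
Lemma evalXn f m : eval (f ^+ m) u = eval f u ^+ m.
Proof. exact: (rmorphXn eval_rmorphism). Qed.
Lemma eval0 : eval 0 u = 0.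
Proof. exact: (rmorph0 eval_rmorphism). Qed.
Lemma eval1 : eval 1 u = 1.
Proof. exact: (rmorph1 eval_rmorphism). Qed.
Lemma evalC c : eval c%:MP u = c%:A.
Proof. by rewrite /eval mmapC. Qed.
Lemma evalX i : eval 'X_i u = u i.
Proof. by rewrite /eval mmapX mmap1U. Qed.

Lemma in_ideal_eval (I : seq {mpoly F[n]}) f :
  (forall g, g \in I -> eval g u = 0) -> in_ideal I f -> eval f u = 0.
Proof.
move=> Iu [c ->]; rewrite /eval rmorph_sum big1 // => i _.
by apply: (etrans (evalM _ _)); rewrite (Iu I`_i) ?mulr0 ?mem_nth.
Qed.

End Eval.

Definition evalE := (evalD, evalB, evalN, evalM, evalXn, eval0, eval1, evalC, evalX).

Lemma eval_ext (F : fieldType) (R : comAlgType F) n f (u v : 'I_n -> R) :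
  u =1 v -> eval f u = eval f v.
Proof. by move/funext->. Qed.

Lemma eval_comp (F : fieldType) (R : comAlgType F) n m (f : {mpoly F[m]})
    (g : 'I_m -> {mpoly F[n]}) (u : 'I_n -> R) :
  eval (mmap (@mpolyC n F) g f) u = eval f (fun i => eval (g i) u).
Proof.
pose q : {rmorphism {mpoly F[m]} -> R} := eval_rmorphism u \o mmap (@mpolyC n F) g.
rewrite [RHS](@rmorph_eval F R m q) // => [c | i]; rewrite /q /= /eval_rmorphism.
  by rewrite -/(eval _ u) mmapC evalC.
by rewrite mmapX mmap1U.
Qed.

Lemma comp_eval (F : fieldType) n m (f : {mpoly F[m]}) (g : 'I_m -> {mpoly F[n]}) :
  mmap (@mpolyC n F) g f = eval f g.
Proof.
rewrite (@rmorph_eval F {mpoly F[n]} m (mmap (@mpolyC n F) g)) // => [c | i].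
  by rewrite /= mmapC -mul_mpolyC mulr1.
by rewrite /= mmapX mmap1U.
Qed.

(** * The additive map [z^p - z] in characteristic [p] *)

Section Frobenius.
Variables (R : comNzRingType) (p : nat).
Hypothesis char_R : p \in [pchar R].

Definition artin_schreier (z : R) := z ^+ p - z.

Lemma frobD (x y : R) : (x + y) ^+ p = x ^+ p + y ^+ p.
Proof. exact: (rmorphD (pFrobenius_aut char_R)). Qed.
Lemma frobB (x y : R) : (x - y) ^+ p = x ^+ p - y ^+ p.
Proof. exact: (rmorphB (pFrobenius_aut char_R)). Qed.
Lemma frobN (x : R) : (- x) ^+ p = - x ^+ p.
Proof. exact: (rmorphN (pFrobenius_aut char_R)). Qed.

Lemma artin_schreierD x y : artin_schreier (x + y) = artin_schreier x + artin_schreier y.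
Proof. by rewrite /artin_schreier frobD opprD addrACA. Qed.
Lemma artin_schreierN x : artin_schreier (- x) = - artin_schreier x.
Proof. by rewrite /artin_schreier frobN opprD opprK. Qed.
Lemma artin_schreierB x y : artin_schreier (x - y) = artin_schreier x - artin_schreier y.
Proof. by rewrite artin_schreierD artin_schreierN. Qed.

Lemma artin_schreier0 : artin_schreier 0 = 0.
Proof. by rewrite /artin_schreier subr0 expr0n gtn_eqF // prime_gt0 // (pcharf_prime char_R). Qed.

End Frobenius.

Lemma rmorph_artin_schreier (R S : comNzRingType) (h : {rmorphism R -> S}) p z :
  h (artin_schreier p z) = artin_schreier p (h z).
Proof. by rewrite /artin_schreier rmorphB rmorphXn. Qed.

Lemma eval_artin_schreier (F : fieldType) (R : comAlgType F) n (u : 'I_n -> R) p f :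
  eval (artin_schreier p f) u = artin_schreier p (eval f u).
Proof. exact: (rmorph_artin_schreier (eval_rmorphism u)). Qed.

(** The constant group [Z/p] is étale, since [z^p - z] has derivative [-1]. In the smoothness proofs
    below this handles the coordinates that cannot be lifted freely. *)
Lemma artin_schreier_lift (R S : comNzRingType) (q : {rmorphism R -> S}) p s :
    p \in [pchar R] -> (forall s, exists r, q r = s) ->
    (forall a b, q a = 0 -> q b = 0 -> a * b = 0) ->
  artin_schreier p s = 0 -> exists2 r, artin_schreier p r = 0 & q r = s.
Proof.
move=> char_R qsurj qker sp0; have [r qr] := qsurj s.
have /eqP sp : s ^+ p == s by rewrite -subr_eq0; apply/eqP.
(* Any lift [r] becomes a root after applying Frobenius, as [r ^+ p - r] has square 0. *)
exists (r ^+ p); last by rewrite rmorphXn qr.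
rewrite /artin_schreier -frobB //; set e := _ - r.
have qe : q e = 0 by rewrite rmorphB rmorphXn qr sp subrr.
have [m ->] : exists m, p = m.+2.
  by case: (p) (prime_gt1 (pcharf_prime char_R)) => [|[|m]] // _; exists m.
by rewrite !exprS mulrA (qker e e) ?mul0r.
Qed.

Lemma forall_ord4 (P : 'I_4 -> Prop) :
  P (@Ordinal 4 0 isT) -> P (@Ordinal 4 1 isT) -> P (@Ordinal 4 2 isT) ->
  P (@Ordinal 4 3 isT) -> forall i, P i.
Proof.
move=> P0 P1 P2 P3 [m lt_m].
by case: m lt_m => [|[|[|[|m]]]] // lt_m; rewrite (bool_irrelevance lt_m isT).
Qed.

Local Notation i0 := (@Ordinal 4 0 isT).
Local Notation i1 := (@Ordinal 4 1 isT).
Local Notation i2 := (@Ordinal 4 2 isT).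
Local Notation i3 := (@Ordinal 4 3 isT).

Definition quad (T : nmodType) (a b c d : T) : {ffun 'I_4 -> T} :=
  [ffun i : 'I_4 => nth 0 [:: a; b; c; d] i].

Lemma quad_eta (T : nmodType) (u : {ffun 'I_4 -> T}) : u = quad (u i0) (u i1) (u i2) (u i3).
Proof. by apply/ffunP; apply: forall_ord4; rewrite ffunE. Qed.

(** * The group and its unipotent radical *)

Section Group.
Variables (F : fieldType) (p : nat).
Hypothesis char_F : p \in [pchar F].
Implicit Type a : F.
Local Notation AS := (artin_schreier p).

(** The scheme [(Z/p)^2 x A^2]: the roots of [z^p - z] form the constant group [Z/p]. *)
Definition heis_eqs : seq {mpoly F[4]} := [:: AS 'X_i0; AS 'X_i1].

Definition heis_mul a (i : 'I_4) : {mpoly F[4 + 4]} :=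
  let l j : {mpoly F[4 + 4]} := 'X_(lshift 4 j) in
  let r j : {mpoly F[4 + 4]} := 'X_(rshift 4 j) in
  quad (l i0 + r i0) (l i1 + r i1) (l i2 + r i2)
    (l i3 + r i3 + l i0 * (AS (r i2) + a%:MP * r i1)) i.

Definition heis_inv a (i : 'I_4) : {mpoly F[4]} :=
  quad (- 'X_i0) (- 'X_i1) (- 'X_i2)
    (- 'X_i3 + 'X_i0 * (AS 'X_i2 + a%:MP * 'X_i1)) i.

Definition heis a : group_data F :=
  GroupData heis_eqs (heis_mul a) (heis_inv a) (fun=> 0).

Section HeisPoints.
Variables (a : F) (R : comAlgType F).
Implicit Types u v : {ffun 'I_4 -> R}.

Lemma pchar_comalg : p \in [pchar R].
Proof. by rewrite pchar_lalg. Qed.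

Lemma heis_point u : point heis_eqs u <-> AS (u i0) = 0 /\ AS (u i1) = 0.
Proof.
split=> [Hu | [u0 u1] f].
  by split; [have := Hu (AS 'X_i0) | have := Hu (AS 'X_i1)];
     rewrite eval_artin_schreier evalX; apply; rewrite !inE eqxx ?orbT.
by rewrite !inE => /orP[] /eqP->; rewrite eval_artin_schreier evalX.
Qed.

Lemma heis_pmul u v : pmul (G := heis a) u v =
  quad (u i0 + v i0) (u i1 + v i1) (u i2 + v i2)
    (u i3 + v i3 + u i0 * (AS (v i2) + a%:A * v i1)).
Proof.
by apply/ffunP; apply: forall_ord4; rewrite !ffunE /= /heis_mul ffunE /=
  !(evalE, eval_artin_schreier) ?(unsplitK (inl _)) ?(unsplitK (inr _)).
Qed.

Lemma heis_pinv u : pinv (G := heis a) u =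
  quad (- u i0) (- u i1) (- u i2) (- u i3 + u i0 * (AS (u i2) + a%:A * u i1)).
Proof.
by apply/ffunP; apply: forall_ord4; rewrite !ffunE /= /heis_inv ffunE /=
  !(evalE, eval_artin_schreier).
Qed.

Lemma heis_pone : pone (heis a) R = quad 0 0 0 0.
Proof. by apply/ffunP; apply: forall_ord4; rewrite !ffunE /= scale0r. Qed.

End HeisPoints.

Lemma quad_point (R : comAlgType F) (b c d e : R) :
  point heis_eqs (quad b c d e) <-> AS b = 0 /\ AS c = 0.
Proof. by rewrite heis_point !ffunE. Qed.

(** Since [AS] is additive in characteristic [p], the correction term [b (AS(u') + a c')] is
    additive in each of its two arguments. It is therefore a 2-cocycle, which is what associativity
    asks for. *)
Lemma heis_group a : group_scheme (heis a).
Proof.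
move=> R inG; have cR := pchar_comalg R.
split; split.
- by rewrite /inG heis_pone quad_point !(artin_schreier0 cR).
- move=> u v /heis_point[u0 u1] /heis_point[v0 v1].
  by rewrite /inG heis_pmul quad_point !(artin_schreierD cR) u0 u1 v0 v1 addr0.
- move=> u /heis_point[u0 u1].
  by rewrite /inG heis_pinv quad_point !(artin_schreierN cR) u0 u1 oppr0.
- move=> u v w _ _ _; rewrite !heis_pmul.
  apply/ffunP; apply: forall_ord4; rewrite !ffunE /= ?addrA ?(artin_schreierD cR) //.
  ring.
- move=> u _; rewrite heis_pone heis_pmul [RHS]quad_eta.
  by apply/ffunP; apply: forall_ord4; rewrite !ffunE /= ?mul0r ?addr0 ?add0r.
- move=> u _; rewrite heis_pone heis_pinv heis_pmul.
  apply/ffunP; apply: forall_ord4; rewrite !ffunE /= ?addNr //.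
  ring.
Qed.

Lemma heis_lift (R S : comAlgType F) (q : {lrmorphism R -> S}) s :
    (forall s, exists r, q r = s) ->
    (forall b c, q b = 0 -> q c = 0 -> b * c = 0) ->
  AS s = 0 -> exists2 r, AS r = 0 & q r = s.
Proof. by apply: artin_schreier_lift; apply: pchar_comalg. Qed.

Lemma heis_smooth : smooth_scheme heis_eqs.
Proof.
move=> R S q qsurj qker u /heis_point[].
move=> /(heis_lift qsurj qker)[r0 r0P qr0] /(heis_lift qsurj qker)[r1 r1P qr1].
have [r2 qr2] := qsurj (u i2); have [r3 qr3] := qsurj (u i3).
exists (quad r0 r1 r2 r3); first by apply/quad_point.
by apply: forall_ord4; rewrite ffunE.
Qed.

Lemma heis_linear a : linear_algebraic_group (heis a).
Proof. by split; [apply: heis_group | apply: heis_smooth]. Qed.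

Lemma heis_subgroup a (H : seq {mpoly F[4]}) :
  subscheme H heis_eqs -> smooth_scheme H ->
  (forall R : comAlgType F,
    [/\ point H (pone (heis a) R),
        forall u v : {ffun 'I_4 -> R}, point H u -> point H v ->
          point H (pmul (G := heis a) u v)
      & forall u : {ffun 'I_4 -> R}, point H u -> point H (pinv (G := heis a) u)]) ->
  subgroup (G := heis a) H.
Proof.
move=> HG Hsm Hgr; split=> //; split=> // R; split; first exact: Hgr.
have [_ [mulA mul1 mulV]] := heis_group a R.
by split=> [u v w /HG + /HG + /HG | u /HG | u /HG];
   [exact: mulA | exact: mul1 | exact: mulV].
Qed.

(** The normal subgroup [G_a^2] of the extension: as [b = 0] on it, the correction term vanishes and
    the law is addition. *)
Definition heis_rad : seq {mpoly F[4]} := [:: 'X_i0; 'X_i1].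

Lemma heis_rad_point (R : comAlgType F) (u : {ffun 'I_4 -> R}) :
  point heis_rad u <-> u i0 = 0 /\ u i1 = 0.
Proof.
split=> [Hu | [u0 u1] f].
  by split; [have := Hu 'X_i0 | have := Hu 'X_i1];
     rewrite evalX; apply; rewrite !inE eqxx ?orbT.
by rewrite !inE => /orP[] /eqP->; rewrite evalX.
Qed.

Lemma heis_rad_sub : subscheme heis_rad heis_eqs.
Proof.
move=> R u /heis_rad_point[u0 u1]; apply/heis_point; rewrite u0 u1.
by rewrite (artin_schreier0 (pchar_comalg R)).
Qed.

Lemma heis_rad_smooth : smooth_scheme heis_rad.
Proof.
move=> R S q qsurj qker u /heis_rad_point[u0 u1].
have [r2 qr2] := qsurj (u i2); have [r3 qr3] := qsurj (u i3).
exists (quad 0 0 r2 r3); first by apply/heis_rad_point; rewrite !ffunE.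
by apply: forall_ord4; rewrite ffunE ?u0 ?u1 ?rmorph0.
Qed.

Lemma heis_rad_subgroup a : subgroup (G := heis a) heis_rad.
Proof.
apply: heis_subgroup; [exact: heis_rad_sub | exact: heis_rad_smooth |].
move=> R; split.
- by rewrite heis_pone; apply/heis_rad_point; rewrite !ffunE.
- move=> u v /heis_rad_point[u0 u1] /heis_rad_point[v0 v1].
  by rewrite heis_pmul; apply/heis_rad_point; rewrite !ffunE /= u0 u1 v0 v1 addr0.
- move=> u /heis_rad_point[u0 u1].
  by rewrite heis_pinv; apply/heis_rad_point; rewrite !ffunE /= u0 u1 oppr0.
Qed.

Lemma heis_rad_normal a : normal_subgroup (G := heis a) heis_rad.
Proof.
split=> [|R g h _ /heis_rad_point[h0 h1]]; first exact: heis_rad_subgroup.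
rewrite heis_pinv !heis_pmul; apply/heis_rad_point; rewrite !ffunE /= h0 h1.
by rewrite !addr0 !subrr.
Qed.

(** Evaluation at the universal point [w] of the plane [b = c = 0] has kernel the ideal of
    [heis_rad] and takes values in a domain, where [e (e - 1) = 0] forces [e = 0] or [e = 1]. *)
Lemma heis_rad_connected : connected_scheme heis_rad.
Proof.
move=> e; pose w : 'I_4 -> {mpoly F[4]} := quad 0 0 'X_i2 'X_i3.
move=> /(in_ideal_eval (R := {mpoly F[4]}) (u := w)) ew.
have {ew}: eval e w * (eval e w - 1) = 0.
  rewrite mulrBr mulr1 -evalM -evalB; apply: ew => g.
  by rewrite !inE => /orP[] /eqP->; rewrite evalX /w ffunE.
have radE f : eval f w = 0 -> in_ideal heis_rad f.
  move=> fw; apply: in_ideal_of_points => R u /heis_rad_point[u0 u1].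
  have <- : eval (eval f w) u = eval f u.
    rewrite -comp_eval eval_comp; apply: eval_ext; apply: forall_ord4;
    by rewrite /w ffunE /= ?evalE ?u0 ?u1.
  by rewrite fw eval0.
move=> /eqP; rewrite mulf_eq0 => /orP[] /eqP ew; [left | right]; apply: radE => //.
by rewrite evalB eval1.
Qed.

End Group.

Section Radical.
Variables (F : fieldType) (p : nat).
Hypothesis char_F : p \in [pchar F].
Implicit Type a : F.
Local Notation AS := (artin_schreier p).

Lemma heis_rad_unipotent a : unipotent (G := heis p a) (heis_rad F).
Proof.
(* The unitriangular matrix with first row [(1, u, w)] and otherwise the identity; such matrices
   multiply by adding [u] and [w], and [b] reads these two entries off again. *)
pose A : 'M[{mpoly F[4]}]_3 :=
  \matrix_(i, j) ((i == j)%:R + ((i == 0) && (j == 1))%:R * 'X_i2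
                  + ((i == 0) && (j == 2))%:R * 'X_i3).
pose b i : {mpoly F[3 * 3]} :=
  quad 0 0 'X_(mxvec_index (m := 3) (n := 3) 0 1) 'X_(mxvec_index (m := 3) (n := 3) 0 2) i.
exists 3, A, b => R AR.
have ev_nat n (c : bool) (w : 'I_n -> R) : eval c%:R w = c%:R.
  by case: c; rewrite ?eval0 ?eval1.
have AE u i j : AR u i j = (i == j)%:R + ((i == 0) && (j == 1))%:R * u i2
                  + ((i == 0) && (j == 2))%:R * u i3.
  by rewrite !mxE !(evalE, ev_nat).
split.
- move=> u _ i j le_ji; rewrite AE.
  by case: (i =P 0) le_ji => [->|_ _]; rewrite ?mul0r ?addr0 //;
     case: j => -[] // ? _; rewrite !mul0r !addr0.
- move=> u v /heis_rad_point[u0 u1] /heis_rad_point[v0 v1].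
  apply/matrixP => i j; rewrite AE heis_pmul !ffunE /= u0 mul0r addr0.
  rewrite [RHS]mxE !big_ord_recl big_ord0 !AE.
  case: i => [[|[|[|i]]]] // lti; case: j => [[|[|[|j]]]] // ltj;
    rewrite /= !(mul0r, mul1r, addr0, add0r, mulr0, mulr1) //;
    exact: addrC.
- move=> u /heis_rad_point[u0 u1]; apply: forall_ord4; rewrite /b ffunE /= ?evalE ?mxvecE ?AE //=.
  all: by rewrite !(mul0r, mul1r, addr0, add0r).
Qed.

(* On a subgroup [H] the functions [1 - 'X_0 ^+ p.-1] and [1 - 'X_1 ^+ p.-1] are idempotent
   and take the value 1 at the unit; if [H] is connected they are thus equal to 1. *)
Lemma heis_rad_largest a : largest_connected_normal_unipotent (G := heis p a) (heis_rad F).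
Proof.
split; first by split;
  [exact: heis_rad_normal | exact: heis_rad_connected | exact: heis_rad_unipotent].
move=> H [[[HG [Hgr _]] _] Hconn _].
have [m pE] : exists m, p = m.+2.
  by case: (p) (prime_gt1 (pcharf_prime char_F)) => [|[|m]] // _; exists m.
have ASE (R : comAlgType F) (u : {ffun 'I_4 -> R}) l :
    (l == i0) || (l == i1) -> point H u -> u l ^+ p = u l.
  move=> li /HG /heis_point[u0 u1]; apply/eqP; rewrite -subr_eq0; apply/eqP.
  by case/orP: li => /eqP->.
have H0 l : (l == i0) || (l == i1) ->
    forall (R : comAlgType F) (u : {ffun 'I_4 -> R}), point H u -> u l = 0.
  move=> li; pose e : {mpoly F[4]} := 1 - 'X_l ^+ m.+1.
  have [|He|He] := Hconn e.
  - apply: in_ideal_of_points => R u Hu; rewrite !evalE.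
    have := ASE R u l li Hu; set z := u l => zp.
    have zz : z ^+ m.+1 * z ^+ m.+1 = z ^+ m.+1.
      by rewrite -exprD addnS -addSn exprD -pE zp -exprS.
    by ring: zz.
  - have [[Hone _ _] _] := Hgr F^o.
    have := in_ideal_eval Hone He.
    by rewrite !evalE ffunE scale0r expr0n subr0 => /eqP; rewrite oner_eq0.
  - move=> R u Hu; rewrite -(ASE R u l li Hu) pE exprS.
    have := in_ideal_eval Hu He; rewrite !evalE addrAC subrr add0r => /eqP.
    by rewrite oppr_eq0 => /eqP->; rewrite mulr0.
move=> R u Hu; apply/heis_rad_point.
by split; apply: H0 Hu.
Qed.

End Radical.

Section BaseChange.
Variables (F L : fieldType) (j : {rmorphism F -> L}) (p : nat).
Local Notation AS := (artin_schreier p).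

Lemma heis_eqs_map : map (map_mpoly j) (heis_eqs F p) = heis_eqs L p.
Proof. by rewrite /heis_eqs /= !rmorph_artin_schreier /= !map_mpolyX. Qed.

Lemma heis_mul_map a : (fun i => map_mpoly j (heis_mul p a i)) = heis_mul p (j a).
Proof.
apply/funext; apply: forall_ord4; rewrite /heis_mul !ffunE /=;
by rewrite !(rmorph_artin_schreier, rmorphD, rmorphM) /= !(map_mpolyX, map_mpolyC).
Qed.

Lemma heis_inv_map a : (fun i => map_mpoly j (heis_inv p a i)) = heis_inv p (j a).
Proof.
apply/funext; apply: forall_ord4; rewrite /heis_inv !ffunE /=;
by rewrite !(rmorph_artin_schreier, rmorphN, rmorphD, rmorphM) /= !(map_mpolyX, map_mpolyC).
Qed.

Lemma heis_one_map : (fun _ : 'I_4 => j 0) = fun=> 0.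
Proof. by apply/funext => i; rewrite rmorph0. Qed.

(** [base_change] unfolded with the literal dimension 4, so that each component can be rewritten at
    a fixed type. *)
Let heis_map a := @GroupData L 4 (map (map_mpoly j) (heis_eqs F p))
  (fun i => map_mpoly j (heis_mul p a i)) (fun i => map_mpoly j (heis_inv p a i))
  (fun=> j 0).

Lemma heis_base_change a : base_change j (heis p a) = heis p (j a).
Proof.
rewrite -[LHS]/(heis_map a) /heis_map.
by rewrite heis_eqs_map heis_mul_map heis_inv_map heis_one_map.
Qed.

(** The type of [U] after base change depends on the group, so the equality [heis_base_change]
    cannot be rewritten directly in this predicate. *)
Lemma heis_base_change_largest a (U : seq {mpoly F[4]}) :
  @largest_connected_normal_unipotent L (heis p (j a)) (map (map_mpoly j) U) ->
  @largest_connected_normal_unipotent L (base_change j (heis p a)) (map (map_mpoly j) U).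
Proof.
rewrite -[base_change _ _]/(heis_map a) /heis_map.
by rewrite heis_eqs_map heis_mul_map heis_inv_map heis_one_map.
Qed.

Lemma heis_rad_base_change : map (map_mpoly j) (heis_rad F) = heis_rad L.
Proof. by rewrite /= !map_mpolyX. Qed.

End BaseChange.

(** * Levi factors *)

Section LeviFactor.
Variables (F : fieldType) (p : nat).
Hypothesis char_F : p \in [pchar F].
Implicit Type a : F.
Local Notation AS := (artin_schreier p).

Lemma heis_unipotent_radical a : unipotent_radical (G := heis p a) (heis_rad F).
Proof.
split=> [|E i _]; first exact: heis_rad_largest.
have char_E : p \in [pchar E] by rewrite (fmorph_pchar i).
apply: heis_base_change_largest.
rewrite heis_rad_base_change.
exact: heis_rad_largest.
Qed.

Lemma no_Levi_factor a :
  (forall w : F, AS w + a != 0) -> ~ exists M, Levi_factor (G := heis p a) M.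
Proof.
move=> aP [M [[MG [Mgr _]] [U [[[Ucnu Umax] _] [Q [f [[Qlin fhom fker _] [s sP]]]]]]]].
(* A Levi factor comes with some radical [U] and some quotient [Q]; maximality of both radicals
   gives [U] the points of [heis_rad]. The argument takes place on [F]-points, [F^o] being [F] as an
   algebra over itself. *)
have UE (u : {ffun 'I_4 -> F^o}) : point U u <-> point (heis_rad F) u.
  have [radcnu radmax] := heis_rad_largest char_F a.
  by split; [apply: radmax | apply: Umax].
have [[_ mulG invG] _] := heis_group char_F a F^o.
have [[_ mulM _] _] := Mgr F^o.
have [fQ fM] := fhom F^o.
have [_ [_ mul1Q _]] := Qlin.1 F^o.
have [sM sQ] := sP F^o.
(* The map to the quotient sees exactly the first two coordinates. *)
have f_eq (g h : {ffun 'I_4 -> F^o}) : point (heis_eqs F p) g -> point (heis_eqs F p) h ->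
    evals f g = evals f h <-> g i0 = h i0 /\ g i1 = h i1.
  move=> gG hG; split=> [fgh | [gh0 gh1]].
    have ghU : point U (pmul (G := heis p a) g (pinv (G := heis p a) h)).
      apply/fker; first by apply: mulG => //; apply: invG.
      rewrite fM ?fgh -?fM //; try exact: invG.
      apply/fker; first by apply: mulG => //; apply: invG.
      by apply/UE/heis_rad_point; rewrite heis_pinv heis_pmul !ffunE /= !subrr.
    move/UE/heis_rad_point: ghU; rewrite heis_pinv heis_pmul !ffunE /=.
    by move=> [/eqP + /eqP]; rewrite !subr_eq0 => /eqP-> /eqP->.
  pose u : {ffun 'I_4 -> F^o} := quad 0 0 (g i2 - h i2) (g i3 - h i3).
  have uU : point U u by apply/UE/heis_rad_point; rewrite !ffunE.
  have uG : point (heis_eqs F p) u by apply: heis_rad_sub => //; apply/UE.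
  have -> : g = pmul (G := heis p a) u h.
    rewrite heis_pmul [LHS]quad_eta !ffunE /= gh0 gh1.
    by rewrite !add0r !subrK mul0r addr0.
  by rewrite fM // (fker _ _ uG).1 // mul1Q //; apply: fQ.
have lift (g : {ffun 'I_4 -> F^o}) : point (heis_eqs F p) g ->
    exists2 m, point M m & m i0 = g i0 /\ m i1 = g i1.
  move=> gG; have [mM fm] := sQ _ (fQ _ gG); exists (evals s (evals f g)) => //.
  by apply/f_eq => //; apply: MG.
have cF : p \in [pchar F^o] by [].
have [|m mM [m0 m1]] := lift (quad 1 0 0 0).
  by apply/quad_point; rewrite artin_schreier0 // /artin_schreier expr1n subrr.
have [|n nM [n0 n1]] := lift (quad 0 1 0 0).
  by apply/quad_point; rewrite artin_schreier0 // /artin_schreier expr1n subrr.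
rewrite !ffunE /= in m0 m1 n0 n1.
(* Both products lie in [M], on which the map to [Q] is injective, and they agree in the first two
   coordinates. *)
have mnC : pmul (G := heis p a) m n = pmul (G := heis p a) n m.
  have mn : point M (pmul (G := heis p a) m n) := mulM _ _ mM nM.
  have nm : point M (pmul (G := heis p a) n m) := mulM _ _ nM mM.
  rewrite -(sM _ mn).2 -(sM _ nm).2; congr evals; apply/f_eq; try exact: MG.
  by rewrite !heis_pmul !ffunE /= m0 m1 n0 n1 !addr0 !add0r.
(* The correction term is [AS (n i2) + a] in [m n] and 0 in [n m]. *)
have := congr1 (fun u : {ffun 'I_4 -> F^o} => u i3) mnC.
rewrite !heis_pmul !ffunE /= m0 n0 n1 m1 mul0r addr0 mul1r mulr1 [n i3 + _]addrC.
rewrite -[RHS]addr0 => /addrI aw; have /eqP := aP (n i2); apply.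
by rewrite -[RHS]aw /GRing.scale /= mulr1.
Qed.

Lemma forall_ord2 (P : 'I_2 -> Prop) :
  P (@Ordinal 2 0 isT) -> P (@Ordinal 2 1 isT) -> forall i, P i.
Proof.
move=> P0 P1 [m lt_m].
by case: m lt_m => [|[|m]] // lt_m; rewrite (bool_irrelevance lt_m isT).
Qed.

Local Notation j0 := (@Ordinal 2 0 isT).
Local Notation j1 := (@Ordinal 2 1 isT).

Definition duo (T : nmodType) (b c : T) : {ffun 'I_2 -> T} :=
  [ffun i : 'I_2 => nth 0 [:: b; c] i].

Definition elem_eqs : seq {mpoly F[2]} := [:: AS 'X_j0; AS 'X_j1].

Definition elem : group_data F :=
  GroupData elem_eqs (fun i => 'X_(lshift 2 i) + 'X_(rshift 2 i))
    (fun i => - 'X_i) (fun=> 0).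

Lemma elem_point (R : comAlgType F) (u : {ffun 'I_2 -> R}) :
  point elem_eqs u <-> AS (u j0) = 0 /\ AS (u j1) = 0.
Proof.
split=> [Hu | [u0 u1] f].
  by split; [have := Hu (AS 'X_j0) | have := Hu (AS 'X_j1)];
     rewrite eval_artin_schreier evalX; apply; rewrite !inE eqxx ?orbT.
by rewrite !inE => /orP[] /eqP->; rewrite eval_artin_schreier evalX.
Qed.

Lemma elem_pmul (R : comAlgType F) (u v : {ffun 'I_2 -> R}) i :
  pmul (G := elem) u v i = u i + v i.
Proof. by rewrite ffunE !evalE (unsplitK (inl _)) (unsplitK (inr _)). Qed.

Lemma elem_pinv (R : comAlgType F) (u : {ffun 'I_2 -> R}) i :
  pinv (G := elem) u i = - u i.
Proof. by rewrite ffunE !evalE. Qed.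

Lemma elem_pone (R : comAlgType F) i : pone elem R i = 0.
Proof. by rewrite ffunE scale0r. Qed.

Lemma elem_linear : linear_algebraic_group elem.
Proof.
split=> [R inQ | R S q qsurj qker u /elem_point[]].
  have cR := pchar_comalg char_F R; split; split.
  - by apply/elem_point; rewrite !elem_pone !(artin_schreier0 cR).
  - move=> u v /elem_point[u0 u1] /elem_point[v0 v1]; apply/elem_point.
    by rewrite !elem_pmul !(artin_schreierD cR) u0 u1 v0 v1 addr0.
  - move=> u /elem_point[u0 u1]; apply/elem_point.
    by rewrite !elem_pinv !(artin_schreierN cR) u0 u1 oppr0.
  - by move=> u v w _ _ _; apply/ffunP => i; rewrite !elem_pmul addrA.
  - by move=> u _; apply/ffunP => i; rewrite elem_pmul elem_pone add0r.
  - by move=> u _; apply/ffunP => i; rewrite elem_pmul elem_pinv elem_pone addNr.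
move=> /(heis_lift char_F qsurj qker)[r0 r0P qr0] /(heis_lift char_F qsurj qker)[r1 r1P qr1].
exists (duo r0 r1); first by apply/elem_point; rewrite !ffunE.
by apply: forall_ord2; rewrite ffunE.
Qed.

Definition heis_proj (i : 'I_2) : {mpoly F[4]} := duo 'X_i0 'X_i1 i.

Lemma heis_projE (R : comAlgType F) (u : {ffun 'I_4 -> R}) :
  evals heis_proj u = duo (u i0) (u i1).
Proof. by apply/ffunP; apply: forall_ord2; rewrite !ffunE /heis_proj ffunE /= evalX. Qed.

Lemma heis_quotient a : quotient_by (G := heis p a) (heis_rad F) (Q := elem) heis_proj.
Proof.
split; first exact: elem_linear.
- move=> R; split=> [u /heis_point[u0 u1] | u v _ _].
    by rewrite heis_projE; apply/elem_point; rewrite !ffunE.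
  apply/ffunP => i; rewrite elem_pmul !heis_projE heis_pmul.
  by case: i => [[|[|i]] //= ?]; rewrite !ffunE.
- move=> R u _; rewrite heis_projE heis_rad_point; split=> [[-> ->] | /ffunP u01].
    by apply/ffunP; apply: forall_ord2; rewrite elem_pone ffunE.
  by split; [have := u01 j0 | have := u01 j1]; rewrite elem_pone ffunE.
(* Injectivity on coordinate rings: the projection has the section [(b, c) |-> (b, c, 0, 0)] as a
   morphism of schemes, whether or not that is a homomorphism. *)
move=> h hG; apply: in_ideal_of_points => R v /elem_point[v0 v1].
have vG : point (heis_eqs F p) (quad (v j0) (v j1) 0 0) by apply/quad_point.
have := in_ideal_eval vG hG; rewrite eval_comp => <-.
by apply: eval_ext; apply: forall_ord2; rewrite /heis_proj ffunE /= evalX ffunE.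
Qed.

(** The factor is the image of [(b, c) |-> (b, c, w c, 0)]. As [c^p = c], one has
    [AS(w c) + a c = (AS w + a) c = 0], so the correction term vanishes on it and the image is
    closed under the group law. *)
Lemma Levi_factor_of_root a (w : F) :
  AS w + a = 0 -> exists M, Levi_factor (G := heis p a) M.
Proof.
move=> wa; pose M : seq {mpoly F[4]} :=
  [:: AS 'X_i0; AS 'X_i1; 'X_i2 - w%:MP * 'X_i1; 'X_i3].
have MP (R : comAlgType F) (u : {ffun 'I_4 -> R}) : point M u <->
    [/\ AS (u i0) = 0, AS (u i1) = 0, u i2 = w%:A * u i1 & u i3 = 0].
  split=> [Hu | [u0 u1 u2 u3] f].
    split; [have := Hu (AS 'X_i0) | have := Hu (AS 'X_i1) |
            have := Hu ('X_i2 - w%:MP * 'X_i1) | have := Hu 'X_i3];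
    rewrite ?eval_artin_schreier !evalE; try by apply; rewrite !inE eqxx ?orbT.
    by move/(_ _)/eqP; rewrite subr_eq0 => /(_ _)/eqP; apply; rewrite !inE eqxx ?orbT.
  rewrite !inE => /or4P[] /eqP->; rewrite ?eval_artin_schreier !evalE //.
  by rewrite u2 subrr.
have ASw (R : comAlgType F) (b : R) : AS b = 0 -> AS (w%:A * b) + a%:A * b = 0.
  move=> /eqP; rewrite subr_eq0 => /eqP bp.
  rewrite /artin_schreier exprMn bp -mulrBl -mulrDl.
  have -> : (w%:A : R) ^+ p - w%:A + a%:A = (AS w + a)%:A.
    by rewrite -[in RHS]/(in_alg R _) rmorphD rmorphB rmorphXn.
  by rewrite wa scale0r mul0r.
have Msub : subscheme M (heis_eqs F p) by move=> R u /MP[u0 u1 _ _]; apply/heis_point.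
exists M; split.
  apply: (heis_subgroup char_F) => // [R S q qsurj qker u /MP[] | R].
    move=> /(heis_lift char_F qsurj qker)[r0 r0P qr0].
    move=> /(heis_lift char_F qsurj qker)[r1 r1P qr1] u2 u3.
    exists (quad r0 r1 (w%:A * r1) 0); first by apply/MP; rewrite !ffunE.
    apply: forall_ord4; rewrite ffunE //= ?u2 ?u3 ?rmorph0 //.
    by rewrite -!scalerAl !mul1r linearZ /= qr1.
  have cR := pchar_comalg char_F R; split.
  - rewrite heis_pone; apply/MP; rewrite !ffunE /= mulr0.
    by rewrite (artin_schreier0 cR).
  - move=> u v /MP[u0 u1 u2 u3] /MP[v0 v1 v2 v3]; rewrite heis_pmul.
    apply/MP; rewrite !ffunE /= !(artin_schreierD cR) u0 u1 v0 v1 addr0.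
    by rewrite u2 v2 u3 v3 ASw // mulrDr mulr0 !addr0.
  - move=> u /MP[u0 u1 u2 u3]; rewrite heis_pinv.
    apply/MP; rewrite !ffunE /= !(artin_schreierN cR) u0 u1 oppr0.
    by rewrite u2 u3 ASw // mulr0 oppr0 addr0 mulrN.
exists (heis_rad F); split; first exact: heis_unipotent_radical.
exists elem, heis_proj; split; first exact: heis_quotient.
exists (fun i => quad 'X_j0 'X_j1 (w%:MP * 'X_j1) 0 i) => R; split.
  move=> u /MP[u0 u1 u2 u3]; rewrite heis_projE; split.
    by apply/elem_point; rewrite !ffunE.
  by apply/ffunP; apply: forall_ord4; rewrite !ffunE /= ?evalE ?ffunE.
move=> v /elem_point[v0 v1]; rewrite heis_projE; split.
  by apply/MP; rewrite !ffunE /= !evalE.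
by apply/ffunP; apply: forall_ord2; rewrite !ffunE /= !evalE.
Qed.

End LeviFactor.

(** * Polynomials over power series *)

Section PowerSeries.
Variable k : fieldType.
Implicit Types f g : fps k.
Local Notation O := (fps k).

Definition fps_t : O := Fps (fun n => if n == 1%N then 1 else 0).
Local Notation t := fps_t.

Lemma fcoefD f g n : fcoef (f + g) n = fcoef f n + fcoef g n.
Proof. by []. Qed.

Lemma fcoef_tM f n : fcoef (t * f) n = if n is m.+1 then fcoef f m else 0.
Proof.
case: n => [|n] /=; first by rewrite big_ord_recl big_ord0 mul0r addr0.
rewrite 2!big_ord_recl /= mul0r add0r mul1r subSS subn0 big1 ?addr0 // => i _.
by rewrite mul0r.
Qed.

Lemma fcoef_tXM m f n : fcoef (t ^+ m * f) n = if (n < m)%N then 0 else fcoef f (n - m).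
Proof.
elim: m n => [|m IHm] n; first by rewrite mul1r subn0.
by rewrite exprS -mulrA fcoef_tM; case: n => [|n] //; rewrite IHm.
Qed.

Lemma fps_tXP m f :
  (forall n, (n < m)%N -> fcoef f n = 0) -> exists g, f = t ^+ m * g.
Proof.
move=> f0; exists (Fps (fun n => fcoef f (n + m))); apply: fpsP => n.
by rewrite fcoef_tXM; case: ltnP => [/f0 // | le_mn] /=; rewrite subnK.
Qed.

(** The [t]-adic topology is separated: equations known modulo every power of [t] become
    equalities. *)
Lemma fps_separated f : (forall n, exists g, f = t ^+ n * g) -> f = 0.
Proof.
move=> fP; apply: fpsP => n; have [g ->] := fP n.+1.
by rewrite fcoef_tXM ltnSn /= if_same.
Qed.

Lemma fps_t_neq0 : t != 0.
Proof. by apply/eqP => /(congr1 (fun f => fcoef f 1)) /eqP; rewrite /= oner_eq0. Qed.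

(* The sum of the series with general term [t ^+ i * g i]. *)
Definition fps_sum (g : nat -> O) : O :=
  Fps (fun n => \sum_(i < n.+1) fcoef (g i) (n - i)%N).

Lemma fps_sumS (g : nat -> O) : fps_sum g = g 0%N + t * fps_sum (fun i => g i.+1).
Proof.
apply: fpsP => n; rewrite fcoefD fcoef_tM /= big_ord_recl subn0.
by case: n => [|n] //; rewrite big_ord0.
Qed.

Lemma fps_sum_trunc (g : nat -> O) n :
  fps_sum g = \sum_(i < n) t ^+ i * g i + t ^+ n * fps_sum (fun i => g (i + n)%N).
Proof.
elim: n g => [|n IHn] g.
  rewrite big_ord0 add0r mul1r; congr fps_sum; apply/funext => i; by rewrite addn0.
rewrite big_ord_recl fps_sumS IHn mul1r mulrDr mulr_sumr addrA; congr (_ + _ + _).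
  by apply: eq_bigr => i _; rewrite mulrA exprS.
rewrite mulrA exprS; congr (_ * fps_sum _).
by apply/funext => i; rewrite addnS.
Qed.

(** After scaling by a constant, [f] is [1 - t h], whose inverse is the geometric series in
    [t h]. *)
Lemma fps_unit_const f : fcoef f 0 != 0 -> f \is a GRing.unit.
Proof.
move=> f0; pose c := fps_const (fcoef f 0)^-1.
have [h hP] : exists h, c * f = 1 - t * h.
  have [h hP] : exists h, 1 - c * f = t ^+ 1 * h.
    apply: fps_tXP => -[|//] _; rewrite /= big_ord_recl big_ord0 addr0 mulVf //.
    by rewrite subrr.
  by exists h; rewrite -[t]expr1 -hP subKr.
pose s := fps_sum (fun i => h ^+ i).
suff : c * f * s = 1.
  by move=> cfs; apply/unitrPr; exists (c * s); rewrite -[RHS]cfs mulrCA mulrA.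
rewrite hP; apply/eqP; rewrite -subr_eq0; apply/eqP.
apply: fps_separated => n.
exists (fps_sum (fun i => h ^+ (i + n)) * (1 - t * h) - h ^+ n).
rewrite /s (fps_sum_trunc _ n).
have -> : \sum_(i < n) t ^+ i * h ^+ i = \sum_(i < n) (t * h) ^+ i.
  by apply: eq_bigr => i _; rewrite exprMn.
have := subrX1 (t * h) n; rewrite exprMn.
move: (\sum_(i < n) _) (fps_sum _) => S R geo.
have -> : (1 - t * h) * (S + t ^+ n * R) = (1 - t * h) * t ^+ n * R - (t * h - 1) * S.
  by ring.
by rewrite -geo; ring.
Qed.

Lemma fps_order f : f != 0 -> exists n g, f = t ^+ n * g /\ fcoef g 0 != 0.
Proof.
move=> f0; have ex : exists n, fcoef f n != 0.
  apply: contrapT => nf; case/eqP: f0; apply: fpsP => n /=.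
  rewrite if_same; apply/eqP; apply: contrapT => /negP fn.
  by apply: nf; exists n.
case: (ex_minnP ex) => n fn nmin.
have [m mn|g fg] := @fps_tXP n f.
  by apply/eqP; apply: contraTT mn => /nmin; rewrite -leqNgt.
by exists n, g; split=> //; move: fn; rewrite {1}fg fcoef_tXM ltnn subnn.
Qed.

(** A name for [fps_const] that carries the ring morphism structure, through which the
    characteristic passes from [k] to [O]. *)
Definition fps_constm (c : k) : O := fps_const c.
Lemma fps_const_zmod : zmod_morphism fps_constm.
Proof. by move=> a b; apply: fpsP => -[|n] //=; rewrite subr0. Qed.
Lemma fps_const_monoid : monoid_morphism fps_constm.
Proof.
split=> // a b; apply: fpsP => n /=; rewrite big_ord_recl /= subn0 big1 ?addr0.
  by case: n => [|n] //=; rewrite mulr0.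
by move=> i _; rewrite /= mul0r.
Qed.
HB.instance Definition _ := GRing.isZmodMorphism.Build k O fps_constm fps_const_zmod.
HB.instance Definition _ := GRing.isMonoidMorphism.Build k O fps_constm fps_const_monoid.

Lemma pchar_fps p : p \in [pchar k] -> p \in [pchar O].
Proof. exact: (rmorph_pchar (fps_constm : {rmorphism k -> O})). Qed.

Section Polynomials.
Import Pdiv.Ring Pdiv.RingMonic.
Implicit Types P Q : {poly O}.
Local Notation T := (fps_t%:P : {poly O}).

Lemma poly_separated P : (forall n, exists Q, P = T ^+ n * Q) -> P = 0.
Proof.
move=> PP; apply/polyP => i; rewrite coef0; apply: fps_separated => n.
by have [Q ->] := PP n; exists Q`_i; rewrite -rmorphXn coefCM.
Qed.

(** The ideal of a monic [Q] is closed [T]-adically: the remainder of [P] modulo [Q] is divisible by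
    every power of [T], hence 0. *)
Lemma poly_closed Q P : Q \is monic ->
  (forall n, exists C R, P = C * Q + T ^+ n * R) -> exists C, P = C * Q.
Proof.
move=> Qm PP; exists (rdivp P Q).
suff r0 : rmodp P Q = 0 by rewrite {1}(rdivp_eq Qm P) r0 addr0.
apply: poly_separated => n; have [C [R ->]] := PP n; exists (rmodp R Q).
by rewrite rmodpD // rmodp_mull // add0r -rmorphXn mul_polyC rmodpZ // mul_polyC.
Qed.

(** The common degree bound keeps the coefficientwise sum of [T ^+ i * G i] a polynomial. *)
Lemma poly_sum d (G : nat -> {poly O}) : (forall i, size (G i) <= d)%N ->
  exists2 S : {poly O}, (size S <= d)%N &
    forall n, exists R, S = \sum_(i < n) T ^+ i * G i + T ^+ n * R.
Proof.
move=> Gd; exists (\poly_(j < d) fps_sum (fun i => (G i)`_j)); first exact: size_poly.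
move=> n; exists (\poly_(j < d) fps_sum (fun i => (G (i + n)%N)`_j)).
apply/polyP => j; rewrite coefD -rmorphXn coefCM !coef_poly coef_sum.
have -> : \sum_(i < n) (T ^+ i * G i)`_j = \sum_(i < n) t ^+ i * (G i)`_j.
  by apply: eq_bigr => i _; rewrite -rmorphXn coefCM.
case: ltnP => [_ | dj]; first exact: fps_sum_trunc.
by rewrite big1 ?mulr0 ?addr0 // => i _; rewrite nth_default ?mulr0 // (leq_trans (Gd i)).
Qed.

Section ArtinSchreier.
Variable p : nat.
Hypothesis char_k : p \in [pchar k].

(** In [O[X]/(Q)], finite free over [O] and so [T]-adically complete, [- sum_i (T X)^(p^i)]
    converges to a solution of [AS(z) = T X]. *)
Lemma artin_schreier_mod Q : Q \is monic ->
  exists S C, artin_schreier p (T * S) - T * 'X = C * Q.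
Proof.
move=> Qm; have cO := pchar_fps char_k.
have cP : p \in [pchar {poly O}] := rmorph_pchar polyC cO.
have p1 := prime_gt1 (pcharf_prime char_k); have p0 := ltnW p1.
(* [- S] is the reduction modulo [Q] of [\sum_i T ^+ (p ^ i - 1) * 'X ^+ (p ^ i)]. *)
pose r i := rmodp 'X^(p ^ i) Q.
have lt_ip i : (i < p ^ i)%N by apply: ltn_expl.
have [i|S _ SP] := @poly_sum (size Q) (fun i => T ^+ (p ^ i - i.+1) * r i).
  rewrite -rmorphXn mul_polyC (leq_trans (size_scale_leq _ _)) //.
  by rewrite ltnW // ltn_rmodpN0 // monic_neq0.
exists (- S); apply: poly_closed => // n; have [R SE] := SP n.
pose A := \sum_(i < n) (T * 'X) ^+ (p ^ i).
have [D DE] : exists D, T * (\sum_(i < n) T ^+ i * (T ^+ (p ^ i - i.+1) * r i)) = A - D * Q.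
  exists (\sum_(i < n) T ^+ (p ^ i) * rdivp 'X^(p ^ i) Q).
  rewrite mulr_sumr mulr_suml -sumrB; apply: eq_bigr => i _.
  have -> : r i = 'X^(p ^ i) - rdivp 'X^(p ^ i) Q * Q.
    by rewrite {1}(rdivp_eq Qm 'X^(p ^ i)) addrC addKr.
  by rewrite exprMn !mulrA -exprS -exprD subnKC // mulrBr mulrA.
(* Frobenius shifts the summands of [A] by one place, so the difference telescopes. *)
have frob : A ^+ p - A = (T * 'X) ^+ (p ^ n) - T * 'X.
  have -> : A ^+ p = \sum_(i < n) (T * 'X) ^+ (p ^ i.+1).
    rewrite -[A ^+ p]/(pFrobenius_aut cP A) rmorph_sum; apply: eq_bigr => i _.
    by rewrite /= pFrobenius_autE -exprM expnSr.
  rewrite -sumrB; pose B i := (T * 'X) ^+ (p ^ i).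
  by rewrite -(big_mkord xpredT (fun i => B i.+1 - B i)) telescope_sumr.
pose Z := T ^+ n * (T * R).
have -> : T * - S = - (A - D * Q + Z).
  by rewrite mulrN SE mulrDr DE /Z; congr (- (_ + _)); rewrite mulrCA.
rewrite (artin_schreierN cP) (artin_schreierD cP) (artin_schreierB cP).
have -> : artin_schreier p A = (T * 'X) ^+ (p ^ n) - T * 'X := frob.
have [C CE] : exists C, artin_schreier p (D * Q) = C * Q.
  exists (D ^+ p * Q ^+ p.-1 - D); rewrite mulrBl -mulrA -exprSr prednK //.
  by rewrite /artin_schreier exprMn.
have [W WE] : exists W, artin_schreier p Z = T ^+ n * W.
  exists ((T ^+ n) ^+ p.-1 * (T * R) ^+ p - T * R).
  by rewrite mulrBr mulrA -exprS prednK // -exprMn.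
have [V VE] : exists V, (T * 'X) ^+ (p ^ n) = T ^+ n * V.
  exists (T ^+ (p ^ n - n) * 'X ^+ (p ^ n)).
  by rewrite exprMn mulrA -exprD subnKC // ltnW.
exists C, (- V - W); rewrite CE WE VE.
ring.
Qed.

End ArtinSchreier.
End Polynomials.
End PowerSeries.

(** * Weierstrass preparation for polynomials over [k[[t]]] *)

Section Weierstrass.
Import Pdiv.Ring Pdiv.RingMonic.
Variable k : fieldType.
Local Notation O := (fps k).
Local Notation T := ((fps_t k)%:P : {poly O}).

Lemma size_TM (P : {poly O}) : (size (T * P)%R <= size P)%N.
Proof. by rewrite mul_polyC size_scale_leq. Qed.

Lemma weierstrass_monic (m f : {poly O}) : m \is monic ->
  exists2 g, g \is monic & exists h, m + T * f = g * (1 + T * h).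
Proof.
move=> mm; have m0 := monic_neq0 mm.
(* The factors are built [T]-adically: at stage [n] they are [m + T * u n] and
   [1 + T * v n], with error [T ^+ n.+1 * e n]; division of the error by [m] gives the
   next corrections. *)
pose step n (s : {poly O} * {poly O} * {poly O}) :=
  let: (u, v, e) := s in let G := rmodp e m in let H := rdivp e m in
  (u + T ^+ n * G, v + T ^+ n * H, - (G * v + H * u) - T ^+ n * (G * H)).
pose st := fix st n := if n is n'.+1 then step n' (st n') else (0, 0, f).
pose u n := (st n).1.1; pose v n := (st n).1.2; pose e n := (st n).2.
pose G n := rmodp (e n) m; pose H n := rdivp (e n) m.
have stS n : (u n.+1 = u n + T ^+ n * G n) * (v n.+1 = v n + T ^+ n * H n) *
    (e n.+1 = - (G n * v n + H n * u n) - T ^+ n * (G n * H n)).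
  by rewrite /G /H /u /v /e /=; case: (st n) => [[x y] z].
have inv n : m + T * f = (m + T * u n) * (1 + T * v n) + T ^+ n.+1 * e n.
  elim: n => [|n IHn]; first by rewrite /u /v /e /= !mulr0 !addr0 mulr1 expr1.
  rewrite IHn !stS {1}(rdivp_eq mm (e n)) -/(G n) -/(H n) !exprS.
  ring.
have uE n : u n = \sum_(i < n) T ^+ i * G i.
  by elim: n => [|n IHn]; rewrite ?big_ord0 // big_ord_recr stS IHn.
(* The corrections [G i] are remainders modulo [m]; their degree bound gives a limit [S] and keeps
   [m + T * S] monic. The other factor is then found by division rather than as a limit. *)
have [i|S Sm SP] := @poly_sum k (size m).-1 G.
  by rewrite -ltnS prednK ?size_poly_gt0 // ltn_rmodpN0.
have lt_S : (size (T * S)%R < size m)%N.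
  by rewrite (leq_ltn_trans (size_TM _)) // (leq_ltn_trans Sm) // prednK ?size_poly_gt0.
pose g := m + T * S.
have gm : g \is monic by rewrite monicE lead_coefDl // -monicE.
exists g => //.
have [C CE] : exists C, m + T * f = C * g.
  apply: poly_closed => // n; have [R SE] := SP n.
  exists (1 + T * v n), (T * (e n - R * (1 + T * v n))).
  rewrite /g SE -uE (inv n) exprS; ring.
(* As [C * g = g + T * (f - S)], uniqueness of division by [g] kills the last term and shows [C] to
   be 1 modulo [T]. *)
have fE : C * g = (1 + T * rdivp (f - S) g) * g + T * rmodp (f - S) g.
  have /= D := rdivp_eq gm (f - S).
  rewrite mulrDl mul1r -addrA -[in RHS]mulrA -mulrDr -D -CE /g; ring.
exists (rdivp (f - S) g); rewrite CE mulrC; congr (_ * _).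
rewrite -[LHS](rdivp_mull gm) fE rdivp_addl_mul_small //.
by rewrite (leq_ltn_trans (size_TM _)) // ltn_rmodpN0 // monic_neq0.
Qed.

Lemma poly_t_dvd (f : {poly O}) :
  (forall n, fcoef f`_n 0 = 0) -> exists g, f = T * g.
Proof.
move=> f0; have dvd n : exists g, f`_n = fps_t k ^+ 1 * g.
  by apply: fps_tXP => -[|//] _; apply: f0.
have [G GE] := choice dvd.
exists (\poly_(n < size f) G n); apply/polyP => n.
rewrite coefCM coef_poly; case: ltnP => [_ | le_n]; last by rewrite nth_default ?mulr0.
by rewrite GE expr1.
Qed.

(** Each division by [T] lowers the order of the leading coefficient, on which the induction
    runs. *)
Lemma poly_primitive (f : {poly O}) : f != 0 ->
  exists n g, f = T ^+ n * g /\ exists i, fcoef g`_i 0 != 0.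
Proof.
move=> f0; have /fps_order[m [c [lf c0]]] : lead_coef f != 0 by rewrite lead_coef_eq0.
elim: m f f0 lf => [|m IHm] f f0 lf.
  by exists 0%N, f; split; [rewrite mul1r | exists (size f).-1; rewrite -/(lead_coef f) lf mul1r].
have [[i fi] | no_i] := pselect (exists i, fcoef f`_i 0 != 0).
  by exists 0%N, f; split; [rewrite mul1r | exists i].
have [|g fg] := @poly_t_dvd f.
  by move=> n; apply/eqP; apply: contrapT => /negP fn; apply: no_i; exists n.
have [||n [h [gh hP]]] := IHm g.
- by apply: contraNneq f0 => g0; rewrite fg g0 mulr0.
- apply: (mulfI (fps_t_neq0 k)); rewrite mulrA -exprS -lf fg lead_coefM.
  by rewrite lead_coefC.
by exists n.+1, h; split=> //; rewrite fg gh exprS mulrA.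
Qed.

(** Let [r] be the largest index of a unit coefficient [c]. The coefficients above [r] are divisible
    by [t], so [f / c] is a monic polynomial of degree [r] plus a multiple of [T]. *)
Lemma weierstrass (f : {poly O}) i : fcoef f`_i 0 != 0 ->
  exists c g h, [/\ c \is a GRing.unit, g \is monic & f = c *: (g * (1 + T * h))].
Proof.
move=> fi; have exr : exists n, fcoef f`_n 0 != 0 by exists i.
have bnd n : fcoef f`_n 0 != 0 -> (n <= size f)%N.
  by apply: contraNT; rewrite -ltnNge => /ltnW le_n; rewrite nth_default.
case: (ex_maxnP exr bnd) => r fr rmax.
pose c := f`_r; have cu : c \is a GRing.unit := fps_unit_const fr.
pose m := c^-1 *: take_poly r.+1 f.
have szm : size (take_poly r.+1 f) = r.+1.
  apply/eqP; rewrite eqn_leq size_take_poly /=.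
  rewrite ltnNge; apply/negP => /leq_sizeP/(_ r (leqnn r)).
  by rewrite coef_take_poly ltnSn => f0; move: cu; rewrite /c f0 unitr0.
have mm : m \is monic.
  rewrite monicE /lead_coef coefZ.
  have -> : size m = r.+1.
    apply/eqP; rewrite eqn_leq (leq_trans (size_scale_leq _ _)) ?szm //=.
    rewrite ltnNge; apply/negP => /leq_sizeP/(_ r (leqnn r)).
    rewrite coefZ coef_take_poly ltnSn mulVr // => /eqP; by rewrite oner_eq0.
  by rewrite coef_take_poly ltnSn mulVr.
have [d dE] : exists d, drop_poly r.+1 f = T * d.
  apply: poly_t_dvd => n; rewrite coef_drop_poly; apply/eqP.
  by apply: contraT => /rmax; rewrite addnS ltnNge leq_addl.
have [g gm [h gh]] := weierstrass_monic (c^-1 *: (d * 'X^(r.+1))) mm.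
exists c, g, h; split=> //.
rewrite -gh scalerDr -scalerAr /m !scalerA mulrV // !scale1r mulrA -dE.
by rewrite poly_take_drop.
Qed.

End Weierstrass.

(** * Discrete valuations *)

Section Valuation.
Variables (F : fieldType) (v : F -> int).
Hypothesis vP : discrete_valuation v.

Lemma val1 : v 1 = 0.
Proof.
have : v (1 * 1) = v 1 + v 1 by apply: (Defs.valM vP); apply: oner_neq0.
by rewrite mulr1 => e; apply: (addIr (v 1)); rewrite add0r -e.
Qed.

Lemma valN a : v (- a) = v a.
Proof.
have [-> | a0] := eqVneq a 0; first by rewrite oppr0.
have n1 : (-1 : F) != 0 by rewrite oppr_eq0 oner_neq0.
have := Defs.valM vP n1 n1; rewrite mulrNN mulr1 val1 => vn1.
by rewrite -mulN1r (Defs.valM vP) //; lia.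
Qed.

Lemma valV a : a != 0 -> v a^-1 = - v a.
Proof.
move=> a0; have := Defs.valM vP a0 (invr_neq0 a0); rewrite mulfV // val1; lia.
Qed.

Lemma valX a n : a != 0 -> v (a ^+ n) = v a *+ n.
Proof.
move=> a0; elim: n => [|n IHn]; first by rewrite expr0 val1.
by rewrite exprS (Defs.valM vP) ?expf_neq0 // IHn mulrS.
Qed.

Lemma val_ge0 n : val_ge v n 0. Proof. by left. Qed.

Lemma val_geE n a : a != 0 -> val_ge v n a -> n <= v a.
Proof. by move=> /eqP a0 []. Qed.

Lemma val_ge_le m n a : m <= n -> val_ge v n a -> val_ge v m a.
Proof. by move=> mn [->|na]; [left | right; lia]. Qed.

Lemma val_geD n a b : val_ge v n a -> val_ge v n b -> val_ge v n (a + b).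
Proof.
have [-> _|a0] := eqVneq a 0; first by rewrite add0r.
have [->|b0] := eqVneq b 0; first by rewrite addr0.
have [->|ab0] := eqVneq (a + b) 0; first by left.
move=> /(val_geE a0) na /(val_geE b0) nb; right.
by apply: le_trans (Defs.valD vP a0 b0 ab0); rewrite le_min na nb.
Qed.

Lemma val_geN n a : val_ge v n a -> val_ge v n (- a).
Proof. by move=> [->|na]; [left; rewrite oppr0 | right; rewrite valN]. Qed.

Lemma val_geB n a b : val_ge v n a -> val_ge v n b -> val_ge v n (a - b).
Proof. by move=> na nb; apply: val_geD => //; apply: val_geN. Qed.

Lemma val_geM m n a b : val_ge v m a -> val_ge v n b -> val_ge v (m + n) (a * b).
Proof.
have [-> _ _|a0] := eqVneq a 0; first by left; rewrite mul0r.
have [-> _ _|b0] := eqVneq b 0; first by left; rewrite mulr0.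
move=> /(val_geE a0) ma /(val_geE b0) nb; right; rewrite (Defs.valM vP) //; lia.
Qed.

Lemma val_geMl n a b : val_ge v 0 a -> val_ge v n b -> val_ge v n (a * b).
Proof. by move=> a0 /(val_geM a0); rewrite add0r. Qed.

Lemma val_ge1 : val_ge v 0 1. Proof. by right; rewrite val1. Qed.

Lemma val_geX a n : val_ge v 0 a -> val_ge v 0 (a ^+ n).
Proof.
by move=> a0; elim: n => [|n IHn]; [apply: val_ge1 | rewrite exprS; apply: val_geMl].
Qed.

Lemma val_ge_expn n a : val_ge v 1 a -> val_ge v n%:Z (a ^+ n).
Proof.
move=> a1; elim: n => [|n IHn]; first exact: val_ge1.
by rewrite exprS -add1n PoszD; apply: val_geM.
Qed.

Lemma val_ge_sum n I (r : seq I) (P : pred I) (E : I -> F) :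
  (forall i, P i -> val_ge v n (E i)) -> val_ge v n (\sum_(i <- r | P i) E i).
Proof.
by move=> En; apply: big_ind => //; [apply: val_ge0 | move=> a b; apply: val_geD].
Qed.

Lemma val_ge_all a : (forall n : nat, val_ge v n%:Z a) -> a = 0.
Proof.
move=> an; apply/eqP; apply: contraT => a0.
by have /(val_geE a0) := an `|v a|.+1; lia.
Qed.

Lemma val_pos_mul a b : val_ge v 0 a -> val_ge v 0 b -> val_ge v 1 (a * b) ->
  val_ge v 1 a \/ val_ge v 1 b.
Proof.
have [-> _ _ _|a0] := eqVneq a 0; first by left; left.
have [-> _ _ _|b0] := eqVneq b 0; first by right; left.
move=> /(val_geE a0) a1 /(val_geE b0) b1.
move=> /(val_geE (mulf_neq0 a0 b0)); rewrite (Defs.valM vP) // => ab.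
have [|] : 1 <= v a \/ 1 <= v b by lia.
  by left; right.
by right; right.
Qed.

Lemma val_ge_horner (q : {poly F}) a n : (forall i, val_ge v n q`_i) -> val_ge v 0 a ->
  val_ge v n q.[a].
Proof.
move=> qn a0; rewrite horner_coef; apply: val_ge_sum => i _.
by rewrite mulrC; apply: val_geMl => //; apply: val_geX.
Qed.

(** If [v a < 0], then [a^d] is minus a sum of terms of value at least [(d - 1) v a], which exceeds
    [d v a]. *)
Lemma val_ge_integral (q : {poly F}) a :
  q \is monic -> (forall i, val_ge v 0 q`_i) -> root q a -> val_ge v 0 a.
Proof.
move=> qm q0 qa; have [->|a0] := eqVneq a 0; first by left.
right; rewrite leNgt; apply/negP => va.
have sq : size q = (size q).-1.+1 by rewrite prednK // size_poly_gt0 monic_neq0.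
move: qa; rewrite /root horner_coef sq big_ord_recr /=.
rewrite -/(lead_coef q) (monicP qm) mul1r addrC addr_eq0 => /eqP ad.
set d := (size q).-1 in ad.
have : val_ge v (v a *+ d - v a) (a ^+ d).
  rewrite ad; apply: val_geN; apply: val_ge_sum => i _; apply: val_geMl => //.
  right; rewrite valX //; move: (nat_of_ord i) (ltn_ord i) => n.
  rewrite -/d => lt_nd; rewrite -(subnKC lt_nd) addSnnS mulrnDr mulrSr addrA addrK.
  by rewrite gerDl mulrn_wle0 // ltW.
by move/(val_geE (expf_neq0 d a0)); rewrite valX //; lia.
Qed.

End Valuation.

(** * Solving [z^p - z = e] in a complete field *)

Section Completion.
Variables (L : fieldType) (p : nat) (w : L -> int).
Hypotheses (char_L : p \in [pchar L]) (wP : discrete_valuation w).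
Hypothesis w_complete : forall u, val_cauchy w u -> exists l, val_limit w u l.

(** The partial sums of [- sum_i e^(p^i)] satisfy [AS (u n) = e - e^(p^n)] and form a Cauchy
    sequence. *)
Lemma artin_schreier_hensel e : val_ge w 1 e -> exists z, artin_schreier p z = e.
Proof.
move=> e1; pose u n := - \sum_(i < n) e ^+ (p ^ i).
have p1 := prime_gt1 (pcharf_prime char_L).
have pge i n : (n <= i)%N -> val_ge w n%:Z (e ^+ (p ^ i)).
  move=> ni; apply: (@val_ge_le _ _ _ (p ^ i)%N); last exact: val_ge_expn.
  by rewrite lez_nat (leq_trans ni) // ltnW // ltn_expl.
have uS n : artin_schreier p (u n) = e - e ^+ (p ^ n).
  rewrite /u; elim: n => [|n IHn].
    by rewrite big_ord0 oppr0 artin_schreier0 // expn0 expr1 subrr.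
  rewrite big_ord_recr opprD /= artin_schreierB // IHn /artin_schreier.
  by rewrite -exprM -expnSr; ring.
have uB n m : val_ge w n%:Z (u (n + m)%N - u n).
  rewrite /u opprK big_split_ord /= opprD addrAC addNr add0r.
  apply: val_geN => //; apply: val_ge_sum => // i _.
  by apply: pge; rewrite leq_addr.
have [n|z zP] := w_complete (u := u).
  exists `|n|%N => i j Ni Nj; apply: (@val_ge_le _ _ _ `|n|%N); first by lia.
  rewrite -(subrKA (u `|n|%N)) -(subnKC Ni) -(subnKC Nj).
  apply: val_geD => //; rewrite -opprB; apply: val_geN => //; exact: uB.
exists z; apply/eqP; rewrite -subr_eq0; apply/eqP; apply: (val_ge_all (v := w)) => n.
have [N NP] := zP n%:Z; pose m := maxn N n.
have zm : val_ge w n%:Z (z - u m).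
  by rewrite -opprB; apply: val_geN => //; apply: NP; rewrite leq_maxl.
rewrite -(subrK (u m) z) artin_schreierD // uS.
rewrite (addrC e) addrA addrK; apply: val_geB => //; last by apply: pge; rewrite leq_maxr.
apply: val_geB => //; have [n0 | n0] := posnP n.
  by rewrite n0 in zm *; apply: val_geX.
rewrite -(prednK (ltnW p1)) exprS mulrC; apply: val_geMl => //.
by apply: val_geX => //; apply: val_ge_le zm.
Qed.

End Completion.

(** * Valuations on a field containing [k[[t]]] *)

Section ValuationOverSeries.
Variables (k F : fieldType) (p : nat) (phi : {rmorphism fps k -> F}) (v : F -> int).
Hypotheses (char_k : p \in [pchar k]) (vP : discrete_valuation v).
Local Notation O := (fps k).
Local Notation t := (fps_t k).
Local Notation AS := (artin_schreier p).
Local Notation ev P a := (map_poly phi P).[a].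
Hypothesis t_neq0 : phi t != 0.

Let char_F : p \in [pchar F].
Proof. exact: (rmorph_pchar phi (pchar_fps char_k)). Qed.

(** Modulo ['X - f] the variable becomes [f], so this is [artin_schreier_mod] evaluated at [f]. *)
Lemma artin_schreier_t (f : O) : exists g, AS (t * g) = t * f.
Proof.
have [S [C SC]] := artin_schreier_mod char_k (monicXsubC f).
exists S.[f]; apply/eqP; rewrite -subr_eq0.
have /eqP := congr1 (fun P : {poly O} => P.[f]) SC.
by rewrite /artin_schreier !hornerE subrr mulr0.
Qed.

(* A negative value at [t * f] would give a strictly larger negative value at a root. *)
Lemma val_series_t f : val_ge v 0 (phi (t * f)).
Proof.
have [->|a0] := eqVneq (phi (t * f)) 0; first by left.
right; rewrite leNgt; apply/negP => va.
have [n le_n] : exists n, (absz (v (phi (t * f)%R)) <= n)%N.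
  by exists (absz (v (phi (t * f)))).
elim: n f a0 va le_n => [|n IHn] f a0 va le_n; first by lia.
have [g gf] := artin_schreier_t f.
have := congr1 phi gf; rewrite rmorph_artin_schreier.
move: a0 va le_n; set a := phi (t * f) => a0 va le_n.
have := IHn g; set b := phi (t * g) => IHb ba.
have p1 := prime_gt1 (pcharf_prime char_k).
have b0 : b != 0.
  by apply/eqP => b0; move: a0; rewrite -ba b0 artin_schreier0 // eqxx.
have vb : v b < 0.
  rewrite ltNge; apply/negP => vb; have : val_ge v 0 a.
    by rewrite -ba; apply: val_geB => //; [apply: val_geX => // |]; right.
  by move/(val_geE a0); lia.
(* If [v b <= v a], then [b^p = b + a] has value at least [v b], whereas [p * v b < v b]. *)
have vab : v a < v b.
  rewrite ltNge; apply/negP => vba.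
  have : val_ge v (v b) (b ^+ p).
    rewrite -(subrK b (b ^+ p)) -/(AS b) ba; apply: val_geD => //; right => //.
  move/(val_geE (expf_neq0 p b0)); rewrite valX // -(prednK (ltnW p1)) mulrSr.
  by rewrite lerDr leNgt pmulrn_llt0 ?vb // -subn1 subn_gt0.
by apply: IHb => //; lia.
Qed.

(* Otherwise the values at [t * f ^+ n] would tend to minus infinity. *)
Lemma val_series f : val_ge v 0 (phi f).
Proof.
have [->|a0] := eqVneq (phi f) 0; first by left.
right; rewrite leNgt; apply/negP => va.
have /val_geE := val_series_t (f ^+ (absz (v (phi t))).+1).
rewrite rmorphM rmorphXn mulf_neq0 ?expf_neq0 // => /(_ isT).
rewrite (Defs.valM vP) ?expf_neq0 // valX //.
have : v (phi f) *+ (absz (v (phi t))).+1 <= (-1) *+ (absz (v (phi t))).+1.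
  by apply: ler_wMn2r; lia.
by rewrite mulNrn natz; lia.
Qed.

Lemma ev_int (P : {poly O}) a : val_ge v 0 a -> val_ge v 0 (ev P a).
Proof.
by move=> a0; apply: val_ge_horner => // i; rewrite coef_map; apply: val_series.
Qed.

Lemma evM (P Q : {poly O}) a : ev (P * Q) a = ev P a * ev Q a.
Proof. by rewrite rmorphM hornerM. Qed.

Lemma evZ c (P : {poly O}) a : ev (c *: P) a = phi c * ev P a.
Proof. by rewrite map_polyZ hornerZ. Qed.

Lemma ev_wide n (P : {poly O}) a : (size P <= n)%N ->
  ev P a = \sum_(i < n) phi P`_i * a ^+ i.
Proof.
move=> Pn; rewrite (horner_coef_wide _ (leq_trans (size_poly _ _) Pn)).
by apply: eq_bigr => i _; rewrite coef_map.
Qed.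

Lemma ev_t (P : {poly O}) a : ev (t%:P * P) a = phi t * ev P a.
Proof. by rewrite rmorphM hornerM /= map_polyC hornerC. Qed.

Lemma integral_root (Q : {poly O}) a : Q \is monic -> val_ge v 0 a ->
  val_ge v 1 (ev Q a) -> exists s, val_ge v 1 (AS s - phi t * a).
Proof.
move=> Qm a0 Qa; have [S [C SC]] := artin_schreier_mod char_k Qm.
exists (ev (t%:P * S) a).
have -> : AS (ev (t%:P * S) a) - phi t * a = ev C a * ev Q a.
  rewrite -hornerM -rmorphM -SC rmorphB rmorph_artin_schreier.
  by rewrite hornerD hornerN ev_t /artin_schreier hornerD hornerN horner_exp
    /= ?ev_t map_polyX hornerX.
by apply: val_geMl => //; apply: ev_int.
Qed.

Section TwoPoles.
Variable x : F.
Hypotheses (x0 : x != 0) (x1 : x - 1 != 0).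
Hypothesis nontrivial : exists2 P : {poly O}, ev P x != 0 & v (ev P x) != 0.

(** By [artin_schreier_hensel] such a [b] becomes a value of [AS] in the completion. *)
Definition approximable b := exists s, val_ge v 1 (AS s - b).

Lemma approximable_small b : val_ge v 1 b -> approximable b.
Proof.
by move=> b1; exists 0; rewrite artin_schreier0 // sub0r; apply: val_geN.
Qed.

Lemma approximableB b c : approximable b -> approximable c -> approximable (b - c).
Proof.
move=> [s sb] [r rc]; exists (s - r); rewrite artin_schreierB //.
have -> : AS s - AS r - (b - c) = (AS s - b) - (AS r - c) by ring.
exact: val_geB.
Qed.

Lemma approximable_t : approximable (phi t).
Proof.
have [g gt] := artin_schreier_t 1; exists (phi (t * g)).
by rewrite -rmorph_artin_schreier gt mulr1 subrr; left.
Qed.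

(** A nonzero series is a power of [t] times a unit [g], and both [g] and its inverse have value at
    least 0. *)
Lemma val_unit_series f : v (phi t) = 0 -> f != 0 -> v (phi f) = 0.
Proof.
move=> t0 /fps_order[n [g [-> g0]]].
have gu := fps_unit_const g0; have phig0 : phi g != 0.
  by apply: contraTneq (rmorph_unit phi gu) => ->; rewrite unitr0.
rewrite rmorphM rmorphXn (Defs.valM vP) ?expf_neq0 // valX // t0 mul0rn add0r.
have /(val_geE phig0) := val_series g.
have /val_geE := val_series g^-1.
rewrite rmorphV // invr_eq0 => /(_ phig0); rewrite valV // oppr_ge0 => vg0 vg1.
by apply/eqP; rewrite eq_le vg0 vg1.
Qed.

Lemma two_poles : approximable (phi t / x) \/ approximable (phi t / (x - 1)).
Proof.
have [tx|tx] := leP 1 (v (phi t / x)); first by left; apply: approximable_small; right.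
have [tx1|tx1] := leP 1 (v (phi t / (x - 1))).
  by right; apply: approximable_small; right.
have /(val_geE t_neq0) vt := val_series t.
move: tx tx1; rewrite !(Defs.valM vP) ?invr_neq0 // !valV // => tx tx1.
have {}vt : 0 <= v (phi t) := vt.
have {}tx : v (phi t) - v x < 1 := tx.
have {}tx1 : v (phi t) - v (x - 1) < 1 := tx1.
have le_tx : v (phi t) <= v x by lia.
have le_tx1 : v (phi t) <= v (x - 1) by lia.
(* From [1 = x - (x - 1)], the value of [t] is at most that of 1. *)
have xx1 : val_ge v (v (phi t)) 1.
  by rewrite -[1](subKr x); apply: val_geB => //; right.
have t0 : v (phi t) = 0.
  by have := val_geE (oner_neq0 F) xx1; rewrite val1 //; lia.
have vx : 0 <= v x by lia.
have vx1 : 0 <= v (x - 1) by lia.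
have not_both : ~ (0 < v x /\ 0 < v (x - 1)).
  case=> x_pos x1_pos; have : val_ge v 1 (x - (x - 1)) by apply: val_geB => //; right.
  by rewrite subKr => /(val_geE (oner_neq0 F)); rewrite val1.
have [x_pos|x_npos] := ltP 0 (v x).
  have x1_unit : v (x - 1) = 0 by lia.
  right; rewrite -[_ / _](subKr (- phi t)); apply: approximableB.
    by rewrite -sub0r; apply: approximableB approximable_t; apply: approximable_small; left.
  have -> : - phi t - phi t / (x - 1) = - (phi t * x / (x - 1)) by field.
  apply: approximable_small; apply: val_geN => //; right.
  by rewrite !(Defs.valM vP) ?mulf_neq0 ?invr_neq0 // valV // t0 x1_unit add0r subr0.
have {x_npos}x_unit : v x = 0 by lia.
have [x_pos|x_npos] := ltP 0 (v (x - 1)).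
  left; rewrite -[_ / _](subKr (phi t)); apply: approximableB; first exact: approximable_t.
  have -> : phi t - phi t / x = phi t * (x - 1) / x by field.
  apply: approximable_small; right.
  by rewrite !(Defs.valM vP) ?mulf_neq0 ?invr_neq0 // valV // t0 x_unit add0r subr0.
have {x_npos}x1_unit : v (x - 1) = 0 by lia.
(* Now [x], [x - 1] and [y] have value 0, while [t / x = t - t y] and [t / (x - 1) = t / y - t]; it
   remains to make [t y] or [t / y] approximable. *)
pose y := (x - 1) / x.
have y0 : y != 0 by rewrite mulf_neq0 ?invr_neq0.
have vy : v y = 0 by rewrite (Defs.valM vP) ?invr_neq0 // valV // x_unit x1_unit.
have [P Px vPx] := nontrivial.
pose d := (size P).-1.
(* [P] rewritten in terms of [y], using [x = 1 / (1 - y)]. *)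
pose P' : {poly O} := \sum_(i < size P) P`_i *: (1 - 'X) ^+ (d - i).
have P'y : ev P' y = ev P x / x ^+ d.
  have sP : (size P).-1.+1 = size P.
    rewrite prednK // size_poly_gt0; apply: contraNneq Px => ->.
    by rewrite rmorph0 horner0.
  rewrite [in RHS](horner_coef_wide _ (size_poly _ _)) rmorph_sum horner_sum mulr_suml.
  apply: eq_bigr => i _; rewrite /= map_polyZ hornerZ coef_map rmorphXn rmorphB rmorph1.
  rewrite /= map_polyX horner_exp !hornerE -mulrA; congr (_ * _).
  have -> : 1 - y = x^-1 by rewrite /y; field.
  have id : (i <= d)%N by rewrite -ltnS sP.
  by rewrite exprVn -{2}(subnKC id) exprD invfM mulrA mulfV ?mul1r ?expf_neq0.
have x_unit_d n : v (x ^+ n) = 0 by rewrite valX // x_unit mul0rn.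
have xd0 : x ^+ d != 0 by rewrite expf_neq0.
have P'y0 : ev P' y != 0 by rewrite P'y mulf_neq0 ?invr_neq0.
have x_int : val_ge v 0 x by right.
have y_int : val_ge v 0 y by right; rewrite vy.
have P'y1 : val_ge v 1 (ev P' y).
  right; rewrite P'y (Defs.valM vP) ?invr_neq0 // valV // x_unit_d subr0.
  by have /(val_geE Px) := ev_int P x_int; lia.
(* Power of [t] and unit factor have value 0, so the positive value of [P'] at [y] falls on one of
   the two Weierstrass factors. *)
have [|n [f' [P'f [i f'i]]]] := @poly_primitive k P'.
  by apply: contraNneq P'y0 => ->; rewrite rmorph0 horner0.
have [c [g [h [cu gm f'E]]]] := weierstrass f'i.
have evE : ev P' y = phi (t ^+ n * c) * (ev g y * ev (1 + t%:P * h) y).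
  by rewrite -evM -evZ P'f f'E -scalerA -[in RHS]mul_polyC rmorphXn.
have tc0 : phi (t ^+ n * c) != 0.
  by apply: contraNneq P'y0 => tc0; rewrite evE tc0 mul0r.
have gh1 : val_ge v 1 (ev g y * ev (1 + t%:P * h) y).
  have gh0 : ev g y * ev (1 + t%:P * h) y != 0.
    by apply: contraNneq P'y0 => gh0; rewrite evE gh0 mulr0.
  move: P'y1; rewrite evE => /(val_geE (mulf_neq0 tc0 gh0)).
  rewrite (Defs.valM vP) // val_unit_series ?add0r //; first by right.
  by apply: contraNneq tc0 => ->; rewrite rmorph0.
have [g1 | h1] := val_pos_mul vP (ev_int g y_int) (ev_int _ y_int) gh1.
  left; have -> : phi t / x = phi t - phi t * y by rewrite /y; field.
  by apply: approximableB approximable_t _; apply: integral_root gm y_int g1.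
right; have -> : phi t / (x - 1) = phi t * y^-1 - phi t by rewrite /y; field; rewrite x1 x0.
apply: approximableB approximable_t.
have z_int : val_ge v 0 y^-1 by right; rewrite valV // vy.
(* [1 + t h], read as a polynomial in [y^-1]. *)
pose m := size h; pose q i : O := (i == 0%N)%:R + t * h`_i.
pose Q : {poly O} := \poly_(j < m.+1) q (m - j)%N.
(* The reversal has leading coefficient [1 + t h_0], a unit; this is why [y^-1], and not [y], is
   integral in this case. *)
have qu : q 0%N \is a GRing.unit.
  by apply: fps_unit_const; rewrite fcoefD fcoef_tM addr0 oner_neq0.
have Qm : (q 0%N)^-1 *: Q \is monic.
  have sQ : size ((q 0%N)^-1 *: Q) = m.+1.
    apply/eqP; rewrite eqn_leq (leq_trans (size_scale_leq _ _)) ?size_poly //=.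
    rewrite ltnNge; apply/negP => /leq_sizeP/(_ m (leqnn m))/eqP.
    by rewrite coefZ coef_poly ltnSn subnn mulVr // oner_eq0.
  by rewrite monicE /lead_coef sQ coefZ coef_poly ltnSn subnn mulVr.
apply: (integral_root Qm z_int).
rewrite map_polyZ hornerZ; apply: val_geMl => //; first exact: val_series.
have -> : ev Q y^-1 = y^-1 ^+ m * ev (1 + t%:P * h) y.
  have sh : (size (1 + t%:P * h)%R <= m.+1)%N.
    rewrite (leq_trans (size_polyD _ _)) // size_poly1 geq_max /=.
    by rewrite (leq_trans (size_TM _)).
  rewrite (ev_wide _ (size_poly _ _)) (ev_wide _ sh).
  rewrite mulr_sumr (reindex_inj rev_ord_inj) /=; apply: eq_bigr => l _.
  have lm : (l <= m)%N by rewrite -ltnS.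
  rewrite coef_poly subSS ltnS leq_subr subKn // mulrCA; congr (_ * _).
    by rewrite /q coefD coef1 coefCM.
  move: (nat_of_ord l) lm => j lm; rewrite !exprVn -[in RHS](subnKC lm).
  rewrite exprD invfM mulrAC mulVf ?expf_neq0 //.
  by rewrite mul1r.
apply: val_geMl; [exact: vP | exact: (val_geX vP m z_int) | exact: h1].
Qed.

End TwoPoles.
End ValuationOverSeries.

(** * The global equation *)

Section Fractions.

Lemma fraction_repr (A : idomainType) (b : {fraction A}) :
  exists n d, d != 0 /\ b * tofrac d = tofrac n.
Proof.
elim/quotW: b => r; exists \n_r, \d_r; have d0 := denom_ratioP r; split=> //.
unlock FracField.tofrac; rewrite -[LHS]FracField.pi_mul; apply/eqmodP.
rewrite /= FracField.equivfE /FracField.mulf !numden_Ratio ?(oner_neq0, mulf_neq0) //.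
by rewrite !mulr1 mulrC.
Qed.

(** With injectivity of [i] this is all that is used of a fraction field, whatever its
    construction. *)
Definition fraction_surj (A B : comNzRingType) (i : {rmorphism A -> B}) :=
  forall b, exists n d, i d != 0 /\ b * i d = i n.

Variables (R : comNzRingType) (K L : fieldType).
Variables (i : {rmorphism R -> K}) (j : {rmorphism {poly K} -> L}).
Hypotheses (i_surj : fraction_surj i) (j_surj : fraction_surj j).

Lemma poly_denominator (q : {poly K}) :
  exists (c : R) (P : {poly R}), i c != 0 /\ (i c)%:P * q = map_poly i P.
Proof.
elim/poly_ind: q => [|q b [c [P [c0 cP]]]].
  by exists 1, 0; rewrite rmorph1 oner_neq0 mulr0 rmorph0.
have [n [d [d0 bE]]] := i_surj b.
exists (c * d), (d%:P * P * 'X + (c * n)%:P); split; first by rewrite rmorphM mulf_neq0.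
rewrite rmorphD !rmorphM /= !map_polyC map_polyX -cP /= -bE !polyCM.
ring.
Qed.

Lemma fraction_surj_poly : fraction_surj (j \o map_poly i).
Proof.
move=> b; have [n [d [d0 bE]]] := j_surj b.
have [c [P [c0 cP]]] := poly_denominator n.
have [e [Q [e0 eQ]]] := poly_denominator d.
have ce0 : j (i e * i c)%:P != 0.
  rewrite -[j _]/((j \o polyC) _) fmorph_eq0.
  by rewrite mulf_neq0.
exists (e%:P * P), (c%:P * Q) => /=.
have -> : map_poly i (c%:P * Q) = d * (i e * i c)%:P.
  by rewrite rmorphM /= map_polyC /= -eQ polyCM; ring.
have -> : map_poly i (e%:P * P) = n * (i e * i c)%:P.
  by rewrite rmorphM /= map_polyC /= -cP polyCM; ring.
by rewrite (rmorphM j d) (rmorphM j n) mulf_neq0 // mulrA bE.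
Qed.

End Fractions.

(** * Poles of [z^p - z] on the projective line *)

Section SimplePoles.
Variables (K : fieldType) (p : nat).
Hypothesis char_K : p \in [pchar K].

(** This is [AS(N / D) = c / (X - a) + d / (X - b)] without denominators. If [D(a) != 0], evaluation
    at [a] gives [c = 0]. Otherwise [(X - a)^2] divides [D^p]; cancelling one factor and evaluating
    at [a] gives [N(a) = 0], against coprimality. *)
Lemma simple_pole_poly (N D : {poly K}) (a b c d : K) : a != b -> coprimep N D ->
  ('X - a%:P) * ('X - b%:P) * (N ^+ p - N * D ^+ p.-1) =
    D ^+ p * (c *: ('X - b%:P) + d *: ('X - a%:P)) -> c = 0.
Proof.
move=> ab cop eqND; have p1 := prime_gt1 (pcharf_prime char_K).
have ab0 : a - b != 0 by rewrite subr_eq0.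
have p0 := ltnW p1.
have [Da|Da] := boolP (root D a); last first.
  have := congr1 (fun P : {poly K} => P.[a]) eqND.
  rewrite !hornerM !hornerXsubC subrr !mul0r hornerD !hornerZ !hornerXsubC subrr.
  rewrite mulr0 addr0 horner_exp => /esym/eqP; rewrite mulf_eq0 expf_eq0 p0 /=.
  by rewrite -rootE (negbTE Da) mulf_eq0 (negbTE ab0) orbF => /eqP.
have cop' : coprimep D N by rewrite coprimep_sym.
have := coprimep_root cop' Da; case/negP.
have [E DE] := factor_theorem _ _ Da.
have : ('X - b%:P) * (N ^+ p - N * D ^+ p.-1) =
    ('X - a%:P) * (E ^+ p * ('X - a%:P) ^+ p.-2 * (c *: ('X - b%:P) + d *: ('X - a%:P))).
  have Xa0 : 'X - a%:P != 0 by rewrite polyXsubC_eq0.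
  apply: (mulfI Xa0).
  rewrite [LHS]mulrA eqND [in LHS]DE exprMn.
  have -> : p = p.-2.+2 by case: (p) p1 => [|[|]].
  by rewrite /= !exprS; ring.
move/(congr1 (fun P : {poly K} => P.[a])).
rewrite !hornerM !hornerXsubC subrr mul0r hornerD hornerN hornerM !horner_exp.
rewrite (rootP Da) expr0n -subn1 subn_eq0 leqNgt p1 /= mulr0 subr0 => /eqP.
by rewrite mulf_eq0 (negbTE ab0) expf_eq0 p0.
Qed.

Variables (L : fieldType) (j : {rmorphism {poly K} -> L}).
Hypotheses (j_eq0 : forall P, (j P == 0) = (P == 0)) (j_surj : fraction_surj j).

Lemma no_simple_poles (z : L) (a b c d : K) : a != b ->
  artin_schreier p z = j c%:P / j ('X - a%:P) + j d%:P / j ('X - b%:P) ->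
  c = 0 /\ d = 0.
Proof.
move=> ab zE; have [n [m [m0 znm]]] := j_surj z.
pose g := gcdp n m; have g0 : g != 0 by rewrite gcdp_eq0 -[m == 0]j_eq0 (negbTE m0) andbF.
pose N := n %/ g; pose D := m %/ g.
have nE : n = N * g by rewrite divpK // dvdp_gcdl.
have mE : m = D * g by rewrite divpK // dvdp_gcdr.
have D0 : j D != 0 by apply: contraNneq m0 => D0; rewrite mE rmorphM D0 mul0r.
have cop : coprimep N D by rewrite coprimep_div_gcd // -[m == 0]j_eq0 m0 orbT.
have zND : z = j N / j D.
  apply: (mulIf m0); rewrite znm nE mE !rmorphM mulrA divfK //.
have p0 := prime_gt0 (pcharf_prime char_K).
have eqND : ('X - a%:P) * ('X - b%:P) * (N ^+ p - N * D ^+ p.-1) =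
    D ^+ p * (c *: ('X - b%:P) + d *: ('X - a%:P)).
  apply/eqP; rewrite -subr_eq0 -j_eq0 rmorphB subr_eq0; apply/eqP.
  move: zE; rewrite zND /artin_schreier -!mul_polyC.
  have : j ('X - a%:P) != 0 by rewrite j_eq0 polyXsubC_eq0.
  have : j ('X - b%:P) != 0 by rewrite j_eq0 polyXsubC_eq0.
  move: ('X - a%:P) ('X - b%:P) => A B B0 A0 E.
  rewrite !(rmorphM, rmorphD, rmorphN, rmorphXn).
  move: (j N) (j D) D0 (j A) A0 (j B) B0 (j c%:P) (j d%:P) E
    => N' D' D'0 A' A'0 B' B'0 c' d'.
  rewrite expr_div_n -(prednK p0) /=; move: p.-1 => q E.
  transitivity (A' * B' * D' ^+ q.+1 * (N' ^+ q.+1 / D' ^+ q.+1 - N' / D')).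
    by rewrite !exprS; field; rewrite D'0 expf_neq0.
  by rewrite E !exprS; field; rewrite A'0 B'0.
split; first exact: simple_pole_poly ab cop eqND.
apply: (@simple_pole_poly N D b a d c) => //; first by rewrite eq_sym.
by rewrite (mulrC ('X - b%:P)) eqND addrC.
Qed.

End SimplePoles.

(** The [p] elements [0, ..., p - 1] already exhaust the roots of [X^p - X]. *)
Lemma prime_subfield (E : fieldType) p (a : E) : p \in [pchar E] ->
  artin_schreier p a = 0 -> exists n, a = n%:R.
Proof.
move=> char_E apa; apply: contrapT => noa; have p_pr := pcharf_prime char_E.
have p1 := prime_gt1 p_pr.
pose P : {poly E} := 'X^p - 'X; pose rs := a :: [seq i%:R | i <- iota 0 p].
have sP : size P = p.+1 by rewrite size_polyDl ?size_polyXn // size_polyN size_polyX.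
have P0 : P != 0 by rewrite -size_poly_gt0 sP.
have nat_pX i : artin_schreier p (i%:R : E) = 0.
  by rewrite /artin_schreier -(pFrobenius_autE char_E) rmorph_nat subrr.
have root_P b : artin_schreier p b = 0 -> root P b.
  by move=> b0; rewrite /root !hornerE -/(artin_schreier p b) b0.
have all_rs : all (root P) rs.
  rewrite /= root_P //=; apply/allP => _ /mapP[i _ ->]; exact: root_P.
have uniq_rs : uniq rs.
  rewrite /=; apply/andP; split.
    by apply/mapP => -[i _ ai]; apply: noa; exists i.
  rewrite map_inj_in_uniq ?iota_uniq // => i j; rewrite !mem_iota !add0n /=.
  wlog le_ij : i j / (i <= j)%N => [IH ip jp ij | _ jp /eqP].
    by have [/IH|/ltnW/IH] := leqP i j; [exact | move/(_ jp ip (esym ij))].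
  rewrite eq_sym -subr_eq0 -natrB // -(dvdn_pcharf char_E) => pij.
  apply/eqP; rewrite eqn_leq le_ij /= -subn_eq0; apply: contraTT pij => ij.
  by rewrite gtnNdvd ?lt0n // (leq_ltn_trans (leq_subr _ _)).
by have := max_poly_roots P0 all_rs uniq_rs; rewrite /= size_map size_iota sP ltnn.
Qed.

(** * Artin-Schreier theory in a cyclic extension of degree [p] *)

Section GaloisPart.
Variables (R : fieldType) (F : splittingFieldType R) (p : nat).
Hypotheses (char_R : p \in [pchar R]) (galF : galois 1 {:F}) (dimF : \dim {:F} = p).

Let char_F : p \in [pchar F].
Proof. by rewrite pchar_lalg. Qed.

(** An automorphism [s] moving [y] generates the group, of prime order [p]. It sends [y] to [y + n]
    and [z] to [z + m] with [n], [m] in the prime field, so [n z - m y] is fixed and lies in [R]. *)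
Lemma artin_schreier_compare (y z : F) (b c : R) :
    artin_schreier p y = b%:A -> artin_schreier p z = c%:A ->
    <<1; y>>%VS = {:F}%VS ->
  exists n m (u : R), (n%:R : R) != 0 /\ artin_schreier p u = n%:R * c - m%:R * b.
Proof.
move=> yb zc Fy; have p_pr := pcharf_prime char_F.
pose G := 'Gal({:F} / 1)%g.
have cardG : #|G| = p by rewrite -(galois_dim galF) dimv1 divn1.
have fix1 (s : gal_of {:F}) (u : R) : s \in G -> s u%:A = u%:A.
  by move=> sG; apply: (fixed_gal (sub1v _) sG); rewrite memvZ ?mem1v.
have shift (s : gal_of {:F}) (w : F) (u : R) : s \in G ->
    artin_schreier p w = u%:A -> exists n, s w = w + n%:R.
  move=> sG wu; have sAS : s (artin_schreier p w) = artin_schreier p (s w).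
    exact: rmorph_artin_schreier.
  have [||n sn] := @prime_subfield F p (s w - w) => //.
    by rewrite artin_schreierB // -sAS wu fix1 // subrr.
  by exists n; rewrite -sn addrC subrK.
have [s sG sy] : exists2 s : gal_of {:F}, s \in G & s y != y.
  apply: contrapT => nos; have y1 : y \in (1%VS : {vspace F}).
    rewrite -(galois_fixedField galF); apply/fixedFieldP; first exact: memvf.
    by move=> s sG; apply/eqP; apply: contrapT => /negP sy; apply: nos; exists s.
  have := dimF; rewrite -Fy (Fadjoin_idP y1) dimv1 => p1.
  by move: p_pr; rewrite -p1.
have [n sn] := shift s y b sG yb; have [m sm] := shift s z c sG zc.
have n0 : (n%:R : F) != 0.
  by apply: contraNneq sy => n0; rewrite sn n0 addr0.
pose w := n%:R * z - m%:R * y.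
have sw : s w = w.
  by rewrite /w rmorphB !rmorphM !rmorph_nat /= sn sm; ring.
have G_s : <[s]>%g = G.
  apply/eqP; rewrite eqEcard cycle_subG sG cardG /=.
  have s_neq1 : s != 1%g by apply: contraNneq sy => ->; rewrite gal_id.
  have : (#[s]%g %| p)%N by rewrite -cardG order_dvdG.
  by move/(prime_nt_dvdP p_pr) => <-; rewrite ?order_eq1 // leqnn.
have w1 : w \in (1%VS : {vspace F}).
  rewrite -(galois_fixedField galF); apply/fixedFieldP; first exact: memvf.
  rewrite -/G -G_s => _ /cycleP[i ->]; elim: i => [|i IHi]; first by rewrite expg0 gal_id.
  by rewrite expgS galM ?memvf // sw IHi.
have [u wu] := vlineP _ _ w1.
have natX i (l : F) : artin_schreier p (i%:R * l) = i%:R * artin_schreier p l.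
  by rewrite /artin_schreier exprMn -(pFrobenius_autE char_F i%:R) rmorph_nat mulrBr.
exists n, m, u; split.
  by apply: contraNneq n0 => nR; rewrite -(rmorph_nat (in_alg F)) nR rmorph0.
apply: (fmorph_inj (in_alg F)); rewrite rmorph_artin_schreier /= -wu.
rewrite /w artin_schreierB // !natX yb zc -!/(in_alg F _) rmorphB !rmorphM !rmorph_nat.
by [].
Qed.

(** If [v] were trivial on [R], minimal polynomials over [R] would make every element of [F]
    integral for [v], but [-1] is a value. *)
Lemma val_nontrivial (v : F -> int) : discrete_valuation v ->
  exists2 b : R, b != 0 & v b%:A != 0.
Proof.
move=> vP; apply: contrapT => triv.
have [a a0 va] := val_onto vP (-1).
have : val_ge v 0 a.
  apply: (val_ge_integral vP (monic_minPoly 1 a)) (root_minPoly 1 a).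
  move=> i; have /polyOverP/(_ i)/vlineP[b ->] := minPolyOver 1 a.
  have [->|b0] := eqVneq b 0; first by left; rewrite scale0r.
  right; have -> : v b%:A = 0 => //; apply/eqP; apply: contrapT => /negP vb.
  by apply: triv; exists b.
by move/(val_geE a0); rewrite va.
Qed.

End GaloisPart.

(** The error [b - AS s] has positive value, hence is itself some [AS z] in the completion; then
    [z + j s] is the root. *)
Lemma completion_root (F L : fieldType) (p : nat) (v : F -> int)
    (j : {rmorphism F -> L}) b : p \in [pchar F] -> discrete_valuation v ->
  is_completion v j -> approximable p v b -> exists z, artin_schreier p z = j b.
Proof.
move=> char_F vP [w [wP wv _ wc]] [s sb].
have char_L : p \in [pchar L] by rewrite (fmorph_pchar j).
have e1 : val_ge w 1 (j (b - artin_schreier p s)).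
  have [->|e0] := eqVneq (b - artin_schreier p s) 0; first by left; rewrite rmorph0.
  right; rewrite wv //; apply: (val_geE e0).
  by rewrite -opprB; apply: val_geN.
have [z zE] := artin_schreier_hensel char_L wP wc e1.
exists (z + j s); rewrite artin_schreierD // zE -rmorph_artin_schreier rmorphB.
by rewrite subrK.
Qed.

Section FunctionField.
Variables (k K L : fieldType) (p : nat) (i : {rmorphism fps k -> K})
  (j : {rmorphism {poly K} -> L}).
Hypotheses (char_k : p \in [pchar k]) (i_eq0 : forall c, (i c == 0) = (c == 0))
  (j_eq0 : forall P, (j P == 0) = (P == 0)) (i_surj : fraction_surj i)
  (j_surj : fraction_surj j).
Variables (F : splittingFieldType L) (y : F).
Let t : L := j (i (fps_t k))%:P.
Let x : L := j 'X.
Hypotheses (galF : galois 1 {:F}) (dimF : \dim {:F} = p).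
Hypotheses (yE : artin_schreier p y = (t / x + t / (x - 1))%:A) (Fy : <<1; y>>%VS = {:F}%VS).

Let char_K : p \in [pchar K].
Proof. exact: (rmorph_pchar i (pchar_fps char_k)). Qed.

Let char_L : p \in [pchar L].
Proof. exact: (rmorph_pchar (j \o polyC) char_K). Qed.

Let x1E : x - 1 = j ('X - 1%:P). Proof. by rewrite rmorphB rmorph1. Qed.

Lemma global_no_root (z : F) : artin_schreier p z != (t / x)%:A.
Proof.
apply/eqP => zE; have [n [m [u [n0 uE]]]] := artin_schreier_compare char_L galF dimF yE zE Fy.
pose ti := i (fps_t k).
(* The residues in [x] of [n t/x - m (t/x + t/(x-1))] at 0 and 1; if both vanish then [n = m = 0] in
   [K]. *)
have [] := @no_simple_poles K p char_K L j j_eq0 j_surj u 0 1 ((n%:R - m%:R) * ti) (- m%:R * ti).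
- by rewrite eq_sym oner_neq0.
- rewrite uE subr0 -/x -x1E !polyCM polyCB polyCN !rmorphM rmorphB rmorphN !rmorph_nat -/t.
  by ring.
have ti0 : ti != 0 by rewrite i_eq0 fps_t_neq0.
move=> /eqP; rewrite mulf_eq0 (negbTE ti0) orbF subr_eq0 => /eqP nm.
move=> /eqP; rewrite mulf_eq0 (negbTE ti0) orbF oppr_eq0 -nm => /eqP nK.
by move: n0; rewrite -(rmorph_nat (j \o polyC)) nK rmorph0 eqxx.
Qed.

Let psi : {rmorphism {poly fps k} -> F} := in_alg F \o (j \o map_poly i).
Let phi : {rmorphism fps k -> F} := psi \o polyC.

Lemma local_root (v : F -> int) (Fv : fieldType) (h : {rmorphism F -> Fv}) :
  discrete_valuation v -> is_completion v h ->
  exists z, artin_schreier p z = h (t / x)%:A.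
Proof.
move=> vP hP.
have char_F : p \in [pchar F] by rewrite pchar_lalg.
have char_Fv : p \in [pchar Fv] by rewrite (fmorph_pchar h).
have psiE P : (map_poly phi P).[x%:A] = psi P.
  have -> : x%:A = psi 'X by rewrite /psi /= map_polyX.
  exact: (esym (poly_initial psi P)).
have phi_t : phi (fps_t k) = t%:A by rewrite /phi /psi /= map_polyC.
have t0 : t != 0 by rewrite j_eq0 polyC_eq0 i_eq0 fps_t_neq0.
have x0 : x != 0 by rewrite j_eq0 polyX_eq0.
have x10 : x - 1 != 0 by rewrite x1E j_eq0 polyXsubC_eq0.
have alg_eq0 (b : L) : (b%:A == 0 :> F) = (b == 0) by rewrite (fmorph_eq0 (in_alg F)).
have nontriv : exists2 P, (map_poly phi P).[x%:A] != 0 & v (map_poly phi P).[x%:A] != 0.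
  have [b b0 vb] := val_nontrivial vP.
  (* Writing [b] as a quotient of polynomials in [x] over [k[[t]]], numerator or denominator has
     nonzero value. *)
  have [P [Q [Q0 bE]]] := fraction_surj_poly i_surj j_surj b.
  have psi_eq0 R : (psi R == 0) = ((j \o map_poly i) R == 0) := alg_eq0 _.
  have psiQ0 : psi Q != 0 by rewrite psi_eq0.
  have psiP0 : psi P != 0 by rewrite psi_eq0 -bE mulf_neq0.
  have psiPQ : psi P = b%:A * psi Q
    by rewrite -[psi P]/(in_alg F ((j \o map_poly i) P)) -bE rmorphM.
  have vPQ : v (psi P) = v b%:A + v (psi Q).
    by rewrite psiPQ (Defs.valM vP) // alg_eq0.
  have [vQ|vQ] := eqVneq (v (psi Q)) 0.
    by exists P; rewrite psiE // vPQ vQ addr0.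
  by exists Q; rewrite psiE.
have := @two_poles k F p phi v char_k vP _ x%:A _ _ nontriv.
have -> : x%:A - 1 = (x - 1)%:A :> F by rewrite scalerBl scale1r.
rewrite phi_t !alg_eq0 => /(_ t0 x0 x10).
have divA (b c : L) : b%:A / c%:A = (b / c)%:A :> F by rewrite -!/(in_alg F _) fmorph_div.
rewrite !divA => -[] /(completion_root char_F vP hP) [z zE]; first by exists z.
(* Here [t / (x - 1)] is [AS z], and [AS y] is the sum of both fractions. *)
exists (h y - z); rewrite artin_schreierB // zE -rmorph_artin_schreier yE.
by rewrite scalerDl rmorphD addrK.
Qed.

End FunctionField.

Lemma root_artin_schreier (F L : fieldType) (h : {rmorphism F -> L}) p (c : F) z :
  root (map_poly h ('X^p - 'X - c%:P)) z = (artin_schreier p z == h c).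
Proof.
rewrite /root !rmorphB /= map_polyXn map_polyX map_polyC !hornerE.
by rewrite subr_eq0.
Qed.

Theorem proposition3p3 (k : fieldType) (p : nat) (char_k : p \in [pchar k])
    (F : splittingFieldType (laurent_ratfun k)) (y : F) :
  let t := ratfun_t k in
  let x := ratfun_x k in
  galois 1 {:F} -> \dim {:F} = p ->
  y ^+ p - y = (t / x + t / (x - 1))%:A -> <<1; y>>%VS = {:F}%VS ->
  let P : {poly F} := 'X^p - 'X - ((t / x)%:A)%:P in
  [/\ ~ (exists z : F, root P z),
      forall v : F -> int, discrete_valuation v ->
        forall (Fv : fieldType) (j : {rmorphism F -> Fv}), is_completion v j ->
        exists z : Fv, root (map_poly j P) z
    & (2 < p)%N ->
      exists G : group_data F,
        [/\ linear_algebraic_group G,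
            exists U, unipotent_radical (G := G) U,
            ~ (exists M, Levi_factor (G := G) M)
          & forall v : F -> int, discrete_valuation v ->
            forall (Fv : fieldType) (j : {rmorphism F -> Fv}),
              is_completion v j ->
            exists M, Levi_factor (G := base_change j G) M]].
Proof.
move=> t x galF dimF yE Fy P.
pose c : F := (t / x)%:A.
pose i : {rmorphism fps k -> laurent k} := @tofrac (fps k).
pose j : {rmorphism {poly laurent k} -> laurent_ratfun k} := @tofrac {poly laurent k}.
have i_eq0 f : (i f == 0) = (f == 0) := tofrac_eq0 f.
have j_eq0 q : (j q == 0) = (q == 0) := tofrac_eq0 q.
have i_surj : fraction_surj i.
  by move=> b; have [n [d [d0 bE]]] := fraction_repr b; exists n, d; rewrite i_eq0.
have j_surj : fraction_surj j.
  by move=> b; have [n [d [d0 bE]]] := fraction_repr b; exists n, d; rewrite j_eq0.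
have no_root z : artin_schreier p z != c.
  exact: (global_no_root char_k i_eq0 j_eq0 j_surj galF dimF yE Fy).
have loc_root v : discrete_valuation v -> forall (Fv : fieldType)
    (h : {rmorphism F -> Fv}), is_completion v h -> exists z, artin_schreier p z = h c.
  move=> vP Fv h hP.
  exact: (local_root char_k i_eq0 j_eq0 i_surj j_surj yE vP hP).
have char_F : p \in [pchar F].
  exact: (rmorph_pchar (in_alg F \o j \o polyC \o i) (pchar_fps char_k)).
split.
(* [P] is viewed as its image under the identity, so that the criterion for roots in extensions
   applies over [F] itself. *)
- case=> z; rewrite -[P](@map_poly_id _ idfun) // (root_artin_schreier idfun).
  by rewrite (negbTE (no_root z)).
- move=> v vP Fv h hP; have [z zc] := loc_root v vP Fv h hP.
  by exists z; rewrite root_artin_schreier; apply/eqP.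
move=> _; exists (heis p (- c)); split.
- exact: heis_linear.
- by exists (heis_rad F); apply: heis_unipotent_radical.
- by apply: no_Levi_factor => // z; rewrite subr_eq0.
move=> v vP Fv h hP; have [z zc] := loc_root v vP Fv h hP.
rewrite heis_base_change; apply: (@Levi_factor_of_root _ _ _ _ z).
  by rewrite (fmorph_pchar h).
by rewrite zc rmorphN subrr.
Qed.
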